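(* Let $n \geq 2$ be an integer. If $\varphi$ is an edge precoloring of $n$ edges of $K_{n,n} \square K_2$ using colors from $\{1,\dots,n+1\}$, then $\varphi$ can be extended to a proper $(n+1)$-edge coloring of $K_{n,n} \square K_2$.
   Context: $G \square H$ denotes the cartesian product of graphs $G$ and $H$. An edge precoloring of a graph is a proper edge coloring of some subset of its edges. A precoloring $\varphi$ is extended by a proper $t$-edge coloring $f$ (colors $\{1,\dots,t\}$) if $f(e)=\varphi(e)$ for every edge $e$ colored under $\varphi$. *)

(* Defs.v *)
From mathcomp Require Import all_boot.

Set Implicit Arguments.
Unset Strict Implicit.
Unset Printing Implicit Defensive.

Record sgraph := SGraph {
  vertex :> finType;
  adj : rel vertex;
  adj_sym : symmetric adj;
  adj_irrefl : irreflexive adj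
}.

Definition edges (G : sgraph) : {set {set G}} :=
  [set [set p.1; p.2] | p : G * G & adj p.1 p.2].

Section CompleteGraph.
Variable n : nat.
Definition complete_adj (x y : 'I_n) := x != y.
Lemma complete_sym : symmetric complete_adj.
Proof. by move=> x y; rewrite /complete_adj eq_sym. Qed.
Lemma complete_irrefl : irreflexive complete_adj.
Proof. by move=> x; rewrite /complete_adj eqxx. Qed.
Definition complete : sgraph := SGraph complete_sym complete_irrefl.
End CompleteGraph.

Section CompleteBipartite.
Variables m n : nat.
Definition bipartite_adj (x y : 'I_m + 'I_n) :=
  match x, y with
  | inl _, inr _ | inr _, inl _ => true
  | _, _ => false
  end.
Lemma bipartite_sym : symmetric bipartite_adj.
Proof. by case=> ? []. Qed.
Lemma bipartite_irrefl : irreflexive bipartite_adj.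
Proof. by case. Qed.
Definition complete_bipartite : sgraph := SGraph bipartite_sym bipartite_irrefl.
End CompleteBipartite.

Section CartesianProduct.
Variables G H : sgraph.
Definition cart_adj (x y : G * H) :=
  (x.1 == y.1) && adj x.2 y.2 || (x.2 == y.2) && adj x.1 y.1.
Lemma cart_sym : symmetric cart_adj.
Proof.
move=> x y; rewrite /cart_adj (eq_sym x.1) (eq_sym x.2).
by rewrite (adj_sym x.1) (adj_sym x.2).
Qed.
Lemma cart_irrefl : irreflexive cart_adj.
Proof. by move=> x; rewrite /cart_adj !adj_irrefl !andbF. Qed.
Definition cartesian_product : sgraph := SGraph cart_sym cart_irrefl.
End CartesianProduct.

Notation "''K_' n" := (complete n) (at level 8, n at level 2, format "''K_' n").
Notation "''K_' ( m , n )" := (complete_bipartite m n)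
  (at level 8, format "''K_' ( m ,  n )").
Notation "G □ H" := (cartesian_product G H) (at level 40, left associativity).

Definition proper_on (G : sgraph) (C : eqType) (S : {set {set G}})
    (c : {set G} -> C) : Prop :=
  forall e1 e2, e1 \in S -> e2 \in S -> e1 != e2 -> e1 :&: e2 != set0 ->
  c e1 != c e2.

(* The t colours are the elements of 'I_t.  Only the values of [f] on
   [edges G] are meaningful. *)
Definition proper_edge_coloring (G : sgraph) (t : nat)
    (f : {set G} -> 'I_t) : Prop :=
  proper_on (edges G) f.

(* In a precoloring, [None] means uncolored. *)
Definition colored (G : sgraph) (t : nat) (phi : {set G} -> option 'I_t) :
    {set {set G}} :=
  [set e | phi e != None].

Definition edge_precoloring (G : sgraph) (t : nat)
    (phi : {set G} -> option 'I_t) : Prop :=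
  colored phi \subset edges G /\ proper_on (colored phi) phi.

Definition extends (G : sgraph) (t : nat) (f : {set G} -> 'I_t)
    (phi : {set G} -> option 'I_t) : Prop :=
  forall e, e \in colored phi -> phi e = Some (f e).

(* Main.v *)
Require Import Defs.
From mathcomp Require Import all_boot zify.

Set Implicit Arguments.
Unset Strict Implicit.
Unset Printing Implicit Defensive.

(* An (n+1)-edge-colouring of K_{n,n} □ K_2 is a pair of properly coloured n x n arrays in which
   corresponding rows (and columns) miss the same colour; that colour is put on the edge joining
   the two copies of the row. Write these missing colours on a border of the array.

   If both copies contain a precoloured cell, put a colour c that phi does not use on all joining
   edges, and replace each prescription d on the joining edge of a row i by the prescription d in
   both copies of a cell (i, j) with j untouched by phi. Each copy then has fewer than n
   prescriptions, hence by Evans' conjecture (Smetaniuk's theorem) is completed to a Latin square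
   on the other n colours. Exchanging c and d along the 4-cycle through (i, j) restores phi.

   If only one copy has precoloured cells, it suffices to complete a single bordered array with n
   prescriptions and copy it. If every colour used is used at least twice, the colour classes are
   found one at a time by Hall's theorem. Otherwise some colour e is used exactly once: if it is on
   the border, exchange as above with c = e; if there is no border prescription, use Evans'
   conjecture in order n+1; if e is in a cell, order the rows and columns so that e lies on the back
   diagonal and everything else above it, and apply induction and Smetaniuk's construction, which
   carries the missing colours along. *)

(** * Hall's theorem and alternating chains *)

Lemma hall (X Y : finType) (y0 : Y) (A : {set X}) (G : X -> {set Y}) :
  (forall B : {set X}, B \subset A -> #|B| <= #|\bigcup_(x in B) G x|) ->
  exists f : X -> Y, {in A, forall x, f x \in G x} /\ {in A &, injective f}.
Proof.
have [k leAk] := ubnP #|A|; elim: k => // k IHk in A G leAk *.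
move=> hallA; have [->|[a aA]] := set_0Vmem A.
  by exists (fun=> y0); split=> x; rewrite inE.
case: (boolP [exists B : {set X}, [&& B \proper A, B != set0 &
   #|\bigcup_(x in B) G x| <= #|B|]]) => [/existsP[B /and3P[ltBA nzB tightB]]|slack].
  have sBA := proper_sub ltBA.
  have ltB := proper_card ltBA.
  have [|C sCB|f [fG finj]] := IHk B G; first by lia.
    by apply: hallA; apply: subset_trans sCB sBA.
  set NB := \bigcup_(x in B) G x in tightB *.
  have [||g [gG ginj]] := IHk (A :\: B) (fun x => G x :\: NB).
  - have : 0 < #|B| by rewrite card_gt0.
    by have := cardsID B A; rewrite (setIidPr sBA); lia.
  - move=> C sC.
    have dCB : [disjoint C & B].
      by rewrite disjoint_subset; apply/subsetP => x /(subsetP sC); rewrite !inE => /andP[].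
    have := hallA (C :|: B); rewrite subUset sBA andbT.
    rewrite (subset_trans sC (subsetDl _ _)) => /(_ isT).
    rewrite cardsU (disjoint_setI0 dCB) cards0 subn0 bigcup_setU -/NB.
    have -> : \bigcup_(x in C) (G x :\: NB) = (\bigcup_(x in C) G x) :\: NB.
      apply/setP => y; rewrite inE; apply/bigcupP/andP => [[x xC]|[nB /bigcupP[x xC yx]]].
        by rewrite inE => /andP[? ?]; split=> //; apply/bigcupP; exists x.
      by exists x => //; rewrite inE nB.
    by rewrite cardsU cardsD; have := subset_leq_card (subsetIl (\bigcup_(x in C) G x) NB); lia.
  have fNB x : x \in B -> f x \in NB.
    by move=> xB; apply/bigcupP; exists x => //; apply: fG.
  have gNB x : x \in A -> x \notin B -> g x \in G x :\: NB.
    by move=> xA xB; apply: gG; rewrite inE xB.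
  exists (fun x => if x \in B then f x else g x); split=> [x xA|x y xA yA] /=.
    by case: ifPn => [/fG//|/(gNB _ xA)]; rewrite inE => /andP[].
  case: ifPn => xB; case: ifPn => yB.
  - exact: finj.
  - by move=> E; have := gNB _ yA yB; rewrite -E inE fNB.
  - by move=> E; have := gNB _ xA xB; rewrite E inE fNB.
  - by apply: ginj; rewrite inE ?xB ?yB.
have [y yGa] : exists y, y \in G a.
  have := hallA [set a]; rewrite sub1set aA cards1 big_set1 => /(_ isT).
  by move=> /card_gt0P.
have [||g [gG ginj]] := IHk (A :\ a) (fun x => G x :\ y).
- by rewrite (cardsD1 a) aA in leAk; lia.
- move=> B sB; have [->|nzB] := eqVneq B set0; first by rewrite cards0.
  have ltBA : B \proper A.
    apply/properP; split; first by apply: subset_trans sB (subsetDl _ _).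
    by exists a => //; apply/negP => /(subsetP sB); rewrite !inE eqxx.
  move/existsPn: slack => /(_ B); rewrite ltBA nzB /= -ltnNge => slackB.
  have -> : \bigcup_(x in B) (G x :\ y) = (\bigcup_(x in B) G x) :\ y.
    apply/setP => z; rewrite in_setD1; apply/bigcupP/andP => [[x xC]|[nB /bigcupP[x xC yx]]].
      by rewrite in_setD1 => /andP[? ?]; split=> //; apply/bigcupP; exists x.
    by exists x => //; rewrite in_setD1 nB.
  by move: slackB; rewrite (cardsD1 y (\bigcup_(x in B) G x)); case: (_ \in _) => /=; lia.
have gP x : x \in A -> x != a -> (g x != y) && (g x \in G x).
  by move=> xA xa; have := gG x; rewrite !inE xa xA => /(_ isT).
exists (fun x => if x == a then y else g x); split=> [x xA|x x' xA x'A] /=.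
  by case: eqP => [->//|/eqP xa]; have /andP[] := gP _ xA xa.
case: eqP => [->|/eqP xa]; case: eqP => [->//|/eqP x'a].
- by move=> E; have := gP _ x'A x'a; rewrite -E eqxx.
- by move=> E; have := gP _ xA xa; rewrite E eqxx.
- by apply: ginj; rewrite !inE ?xa ?x'a.
Qed.

Lemma exchange_chain (Y K : finType) (J : {set Y}) (z b : Y -> K) (j0 : Y) :
  j0 \in J -> {in J &, injective z} -> {in J &, injective b} ->
  z j0 \notin b @: J ->
  exists (Q : {set Y}) (t : Y),
    [/\ Q \subset J, j0 \in Q, t \in Q, b t \notin z @: J &
        z @: (Q :\ j0) = b @: (Q :\ t)].
Proof.
have [k leJk] := ubnP #|J|; elim: k => // k IHk in J j0 leJk *.
move=> j0J zI bI zb.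
have [/imsetP[j1 j1J bz]|nbz] := boolP (b j0 \in z @: J); last first.
  by exists [set j0], j0; rewrite sub1set j0J !set11 nbz setDv !imset0.
have j10 : j1 != j0.
  by apply: contraNneq zb => E; rewrite -{1}E -bz imset_f.
have sub x : x \in J :\ j0 -> x \in J by rewrite inE => /andP[].
have [||x y /sub xJ /sub yJ|x y /sub xJ /sub yJ||Q [t [sQ j1Q tQ bt zbQ]]] :=
  IHk (J :\ j0) j1.
- by rewrite (cardsD1 j0) j0J in leJk; lia.
- by rewrite in_setD1 j10.
- exact: zI.
- exact: bI.
- rewrite -bz; apply/imsetP => -[x]; rewrite in_setD1 => /andP[xj0 xJ] /bI E.
  by move: xj0; rewrite -(E j0J xJ) eqxx.
have j0Q : j0 \notin Q by apply/negP => /(subsetP sQ); rewrite !inE eqxx.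
have tJ : t \in J by apply: sub; apply: (subsetP sQ).
have tj0 : t != j0 by apply: contraNneq j0Q => <-.
exists (j0 |: Q), t; split.
- by rewrite subUset sub1set j0J (subset_trans sQ) // subsetDl.
- exact: setU11.
- by rewrite inE tQ orbT.
- apply: contra bt => /imsetP[x xJ E]; rewrite E; apply: imset_f.
  by rewrite !inE xJ andbT; apply: contraNneq zb => <-; rewrite -E imset_f.
rewrite setU1K //.
have -> : (j0 |: Q) :\ t = j0 |: (Q :\ t).
  apply/setP => x; rewrite !inE; case: (x =P j0) => [->|] //=.
  by rewrite eq_sym tj0.
by rewrite imsetU1 bz -zbQ -imsetU1 setD1K.
Qed.

(** * Smetaniuk's construction *)

(* Elements outside [A] have rank [0]: they stand for border lines. *)
Definition ranking (T : finType) (A : {set T}) (r : T -> nat) :=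
  [/\ {in A &, injective r}, {in A, forall x, r x < #|A|}
    & forall x, x \notin A -> r x = 0].

Lemma ranking_onto (T : finType) (A : {set T}) (r : T -> nat) k :
  ranking A r -> k < #|A| -> exists2 x, x \in A & r x = k.
Proof.
move=> [rI rlt _] ltk.
have uA : uniq (map r (enum A)).
  by rewrite map_inj_in_uniq ?enum_uniq // => x y; rewrite !mem_enum; apply: rI.
have sub : {subset map r (enum A) <= iota 0 #|A|}.
  by move=> y /mapP[x]; rewrite mem_enum mem_iota => xA ->; apply: rlt.
have [|_ /(_ k)] := uniq_min_size uA sub.
  by rewrite size_iota size_map -cardE.
rewrite mem_iota ltk => /mapP[x]; rewrite mem_enum => xA ->; by exists x.
Qed.

Section Rectangle.
Variables (X Y K : finType) (R : {set X}) (C : {set Y}) (rho : X -> nat) (kap : Y -> nat).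
Variables (rl : X) (cl : Y) (b : X -> Y -> K) (e : K).
Let m := #|R|.
Hypotheses (cardRC : #|C| = #|R|) (rhoP : ranking R rho) (kapP : ranking C kap).
Hypotheses (rlR : rl \in R) (clC : cl \in C) (rho_rl : rho rl = m.-1) (kap_cl : kap cl = m.-1).
Hypothesis b_row : forall i, i \in R :\ rl -> {in C :\ cl &, injective (b i)}.
Hypothesis b_col : forall j, j \in C :\ cl -> {in R :\ rl &, injective (b^~ j)}.
Hypothesis b_e : forall i j, i \in R :\ rl -> j \in C :\ cl -> b i j != e.

(* After the rows of rank below [k] have been processed, column [j] contains [e] and the colours that
   [b] has there, minus [z j]: this is the colour pushed out to the last column [cl], and it is [e]
   as long as [e] itself has not been placed in column [j]. *)
Record partial_rectangle k (v : X -> Y -> K) (z : Y -> K) : Prop := PartialRectangle {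
  pr_row : forall i, i \in R -> rho i < k -> {in C &, injective (v i)};
  pr_row_val : forall i j, i \in R -> rho i < k -> j \in C ->
    v i j = e \/ exists2 j', j' \in C :\ cl & v i j = b i j';
  pr_col : forall j i i', j \in C -> i \in R -> i' \in R -> rho i < k -> rho i' < k ->
    v i j = v i' j -> i = i';
  pr_col_val : forall i j, i \in R -> rho i < k -> j \in C :\ cl -> v i j != z j /\
    (v i j = e \/ exists i', [/\ i' \in R, rho i' < k & v i j = b i' j]);
  pr_z_val : forall j, j \in C :\ cl ->
    z j = e \/ exists i', [/\ i' \in R, rho i' < k & z j = b i' j];
  pr_z_e : forall j, j \in C :\ cl -> (z j == e) = (kap j < m - k);
  pr_z_inj : forall j j', j \in C :\ cl -> j' \in C :\ cl -> z j != e ->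
    z j = z j' -> j = j';
  pr_last : forall i, i \in R -> rho i < k ->
    v i cl = e \/ exists j, [/\ j \in C :\ cl, z j != e & v i cl = z j];
  pr_above : forall i j, i \in R -> rho i < k -> j \in C -> rho i + kap j < m.-1 ->
    v i j = b i j;
  pr_diag : forall i j, i \in R -> rho i < k -> j \in C -> rho i + kap j = m.-1 ->
    v i j = e }.

Let rho_inj : {in R &, injective rho}. Proof. by case: rhoP. Qed.
Let kap_inj : {in C &, injective kap}. Proof. by case: kapP. Qed.
Let kap_lt : {in C, forall j, kap j < m}. Proof. by case: kapP => _; rewrite cardRC. Qed.

Let rowP i : i \in R -> rho i < m.-1 -> i \in R :\ rl.
Proof.
by move=> iR lti; rewrite in_setD1 iR andbT; apply: contraTneq lti => ->; rewrite rho_rl ltnn.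
Qed.

Let colP j : j \in C :\ cl -> (j \in C) /\ (kap j < m.-1).
Proof.
rewrite in_setD1 => /andP[jcl jC]; split=> //.
have : kap j != kap cl by apply: contraNneq jcl => /kap_inj->.
by rewrite kap_cl; have := kap_lt jC; lia.
Qed.

Let m_gt0 : 0 < m. Proof. by rewrite card_gt0; apply/set0Pn; exists rl. Qed.

Lemma partial_rectangle1 : 1 < m ->
  partial_rectangle 1 (fun i j => if j == cl then e else b i j) (fun=> e).
Proof.
move=> m1.
have inD j : j \in C -> j != cl -> j \in C :\ cl by rewrite in_setD1 => -> ->.
have rho1 i : i \in R -> rho i < 1 -> i \in R :\ rl by move=> iR i0; apply: rowP => //; lia.
split.
- move=> i iR i0 j j' jC j'C; case: eqP => [->|/eqP jcl]; case: eqP => [->|/eqP j'cl] //.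
  + by move=> E; have := b_e (rho1 _ iR i0) (inD _ j'C j'cl); rewrite -E eqxx.
  + by move=> E; have := b_e (rho1 _ iR i0) (inD _ jC jcl); rewrite E eqxx.
  + by apply: b_row; rewrite ?inD ?rho1.
- move=> i j iR i0 jC; case: eqP => [_|/eqP jcl]; [by left|right].
  by exists j => //; apply: inD.
- by move=> j i i' jC iR i'R i0 i'0 _; apply: rho_inj => //; lia.
- move=> i j iR i0 jC; have := jC; rewrite in_setD1 => /andP[/negPf-> _].
  by split; [apply: b_e => //; apply: rho1|right; exists i].
- by move=> j jC; left.
- by move=> j /colP[_]; rewrite eqxx; lia.
- by move=> j j' _ _; rewrite eqxx.
- by move=> i iR i0; rewrite eqxx; left.
- move=> i j iR i0 jC lt; case: eqP => // E.
  by move: lt; rewrite E kap_cl; lia.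
- move=> i j iR i0 jC E; case: eqP => // /eqP jcl.
  by have [_] := colP (inD _ jC jcl); lia.
Qed.

(* Placing [e] in row [i0] at column [j0] pushes [b i0 j0] out. If the last column already has that
   colour, it was pushed out of some column [j1], where it may now be put, pushing out [b i0 j1],
   and so on; [exchange_chain] is this process. *)
Lemma partial_rectangleS k v z : 0 < k -> k.+1 < m ->
  partial_rectangle k v z -> exists v' z', partial_rectangle k.+1 v' z'.
Proof.
move=> k0 km [row row_val col col_val z_val z_e z_inj last above diag].
have [i0 i0R rho0] : exists2 i, i \in R & rho i = k by apply: ranking_onto => //; lia.
have [j0 j0C kap0] : exists2 j, j \in C & kap j = m.-1 - k.
  by apply: ranking_onto => //; lia.
have i0R' : i0 \in R :\ rl by apply: rowP => //; lia.
have j0C' : j0 \in C :\ cl.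
  by rewrite in_setD1 j0C andbT; apply/eqP => E; move: kap0; rewrite E kap_cl; lia.
have earlier i : i \in R -> rho i < k -> i \in R :\ rl by move=> *; apply: rowP => //; lia.
have split_row i : i \in R -> rho i < k.+1 -> i = i0 \/ rho i < k /\ i != i0.
  move=> iR; rewrite ltnS leq_eqVlt => /orP[/eqP E|lt]; first by left; apply: rho_inj; rewrite ?E.
  by right; split=> //; apply: contraTneq lt => ->; rewrite rho0 ltnn.
set J := [set j in C :\ cl | m.-1 - k <= kap j].
have JP j : reflect (j \in C :\ cl /\ m.-1 - k <= kap j) (j \in J).
  by rewrite [j \in J]in_set; apply: andP.
have j0J : j0 \in J by apply/JP; split=> //; rewrite kap0.
have zj0 : z j0 = e by apply/eqP; rewrite z_e // kap0; lia.
have zne j : j \in J -> j != j0 -> z j != e.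
  move=> /JP[jC le] jj0; rewrite z_e //.
  have : kap j != kap j0 by apply: contraNneq jj0 => /kap_inj->//; case/colP: jC.
  by rewrite kap0; lia.
have zJinj : {in J &, injective z}.
  move=> j j' jJ j'J E; have [Ej|jj0] := eqVneq j j0.
    have [->//|j'j0] := eqVneq j' j0; move: (zne _ j'J j'j0).
    by rewrite -E Ej zj0 eqxx.
  by apply: z_inj (zne _ jJ jj0) E; [case/JP: jJ|case/JP: j'J].
have bJinj : {in J &, injective (b i0)}.
  by move=> j j' /JP[jC _] /JP[j'C _]; apply: b_row.
have [|Q [t [sQJ j0Q tQ btJ zbQ]]] := exchange_chain j0J zJinj bJinj.
  by rewrite zj0; apply/imsetP => -[j /JP[jC _] E]; have := b_e i0R' jC; rewrite -E eqxx.
have QJ j : j \in Q -> j \in J by apply/subsetP.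
have QC j : j \in Q -> j \in C :\ cl by move=> /QJ/JP[].
have tC := QC _ tQ.
have zQ j : j \in Q -> z j = e \/ exists2 j', j' \in Q & z j = b i0 j'.
  move=> jQ; have [->|jj0] := eqVneq j j0; [by left|right].
  have : z j \in z @: (Q :\ j0) by apply: imset_f; rewrite in_setD1 jj0.
  by rewrite zbQ => /imsetP[j' /setD1P[_ j'Q] E]; exists j'.
have bQ j : j \in Q -> j != t -> exists2 j', j' \in Q :\ j0 & b i0 j = z j'.
  move=> jQ jt; have : b i0 j \in b i0 @: (Q :\ t) by apply: imset_f; rewrite in_setD1 jt.
  by rewrite -zbQ => /imsetP[j' j'Q E]; exists j'.
have btz j : j \in J -> b i0 t = z j -> False.
  by move=> jJ E; move/negP: btJ; apply; rewrite E imset_f.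
have inC' j : j \in C -> j != cl -> j \in C :\ cl by rewrite in_setD1 => -> ->.
pose w j := if j == cl then b i0 t else if j \in Q then z j else b i0 j.
pose z' j := if j \in Q then b i0 j else z j.
have clQ : cl \notin Q by apply/negP => /QC; rewrite in_setD1 eqxx.
have wC j : j \in C :\ cl -> w j = if j \in Q then z j else b i0 j.
  by rewrite /w in_setD1 => /andP[/negPf->].
have z'e j : j \in C :\ cl -> (z' j == e) = (kap j < m - k.+1).
  move=> jC; rewrite /z'; case: ifPn => jQ.
    have /JP[_ le] := QJ _ jQ; rewrite (negPf (b_e i0R' jC)); symmetry; apply/negbTE.
    by move: le km k0; clear; lia.
  rewrite z_e //; have : kap j != kap j0.
    by apply: contraNneq jQ => /kap_inj->//; case/colP: jC.
  by rewrite kap0; move: km k0; clear; lia.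
have Jz' j : j \in C :\ cl -> z' j != e -> j \in J.
  by move=> jC; rewrite z'e // => h; apply/JP; split=> //; move: h km; clear; lia.
have wcl : w cl = b i0 t by rewrite /w eqxx.
have w_ne_prev i j : i \in R -> rho i < k -> j \in C -> v i j != w j.
  move=> iR ik jC; have [->|jcl] := eqVneq j cl.
    rewrite wcl; case: (last i iR ik) => [->|[j' [j'C zj' ->]]].
      by rewrite eq_sym b_e.
    apply/eqP => E; apply: (@btz j') => //; apply/JP; split=> //.
    by move: zj' km; rewrite z_e //; clear; lia.
  have jC' := inC' _ jC jcl; rewrite wC //; have [vz] := col_val _ _ iR ik jC'.
  case: ifP => // _ [->|[i' [i'R i'k ->]]]; first by rewrite eq_sym b_e.
  apply/eqP => /(b_col jC') E; have := i'k; rewrite E ?rho0 ?ltnn //; exact: earlier.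
exists (fun i => if i == i0 then w else v i), z'; split.
- move=> i iR ik; case: (split_row _ iR ik) => [->|[{}ik /negPf->]]; last exact: row.
  rewrite eqxx => j j' jC j'C.
  have wt j1 : j1 \in C :\ cl -> w j1 != b i0 t.
    move=> j1C; rewrite wC //; case: ifPn => j1Q.
      by apply/eqP => E; apply: (@btz j1) => //; apply: QJ.
    by apply: contraNneq j1Q => /b_row->.
  have [->|jcl] := eqVneq j cl; have [->|j'cl] := eqVneq j' cl => //.
  + by rewrite wcl => E; have := wt _ (inC' _ j'C j'cl); rewrite -E eqxx.
  + by rewrite wcl => E; have := wt _ (inC' _ jC jcl); rewrite E eqxx.
  move: (inC' _ jC jcl) (inC' _ j'C j'cl) => {}jC {}j'C.
  have cross j1 j2 : j1 \in Q -> j2 \in C :\ cl -> j2 \notin Q -> z j1 = b i0 j2 -> False.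
    move=> j1Q j2C j2Q E; case: (zQ _ j1Q) => [E'|[j3 j3Q E']].
      by have := b_e i0R' j2C; rewrite -E E' eqxx.
    by move: j2Q; rewrite -(b_row i0R' (QC _ j3Q) j2C) ?j3Q // -E'.
  rewrite !wC //; case: ifPn => jQ; case: ifPn => j'Q.
  + by apply: zJinj; apply: QJ.
  + by move=> /cross[].
  + by move=> E; case: (cross j' j).
  + exact: b_row.
- move=> i j iR ik jC; case: (split_row _ iR ik) => [->|[{}ik /negPf->]]; last exact: row_val.
  rewrite eqxx; have [->|jcl] := eqVneq j cl; first by rewrite wcl; right; exists t.
  rewrite wC ?inC' //; case: ifPn => jQ; last by right; exists j; rewrite ?inC'.
  by case: (zQ _ jQ) => [|[j' j'Q E]]; [left|right; exists j' => //; apply: QC].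
- move=> j i i' jC iR i'R ik i'k.
  case: (split_row _ iR ik) => [->|[{}ik /negPf ii0]];
  case: (split_row _ i'R i'k) => [->|[{}i'k /negPf i'i0]] //.
  + by rewrite eqxx i'i0 => E; have := w_ne_prev _ _ i'R i'k jC; rewrite E eqxx.
  + by rewrite eqxx ii0 => E; have := w_ne_prev _ _ iR ik jC; rewrite E eqxx.
  + by rewrite ii0 i'i0; apply: col.
- move=> i j iR ik jC; have [jC1 jm] := colP jC.
  case: (split_row _ iR ik) => [->|[{}ik /negPf ->]].
    rewrite eqxx wC // /z'; case: ifPn => jQ.
      have zv := z_val _ jC; split; last first.
        by case: zv => [|[i' [? ? ?]]]; [left|right; exists i'; split=> //; apply: leqW].
      case: zv => [->|[i' [i'R i'k ->]]]; first by rewrite eq_sym b_e.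
      apply/eqP => /(b_col jC) E; have := i'k; rewrite E ?rho0 ?ltnn //; exact: earlier.
    split; last by right; exists i0; rewrite rho0.
    case: (z_val _ jC) => [->|[i' [i'R i'k ->]]]; first by rewrite b_e.
    rewrite eq_sym; apply/eqP => /(b_col jC) E; have := i'k; rewrite E ?rho0 ?ltnn //; exact: earlier.
  have [vz vv] := col_val _ _ iR ik jC; split; last first.
    by case: vv => [|[i' [? ? ?]]]; [left|right; exists i'; split=> //; apply: leqW].
  rewrite /z'; case: ifP => // _; case: vv => [->|[i' [i'R i'k ->]]]; first by rewrite eq_sym b_e.
  apply/eqP => /(b_col jC) E; have := i'k; rewrite E ?rho0 ?ltnn //; exact: earlier.
- move=> j jC; rewrite /z'; case: ifP => _; first by right; exists i0; rewrite rho0.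
  by case: (z_val _ jC) => [|[i' [? ? ?]]]; [left|right; exists i'; split=> //; apply: leqW].
- exact: z'e.
- move=> j j' jC j'C nej E; have jJ := Jz' _ jC nej.
  have j'J : j' \in J by apply: Jz' => //; rewrite -E.
  have cross j1 j2 : j1 \in Q -> j2 \in J -> j2 \notin Q -> b i0 j1 = z j2 -> False.
    move=> j1Q j2J j2Q E'; have [E1|j1t] := eqVneq j1 t.
      by apply: (@btz j2) => //; rewrite -E1.
    have [j3 /setD1P[_ j3Q] E3] := bQ _ j1Q j1t.
    have E23 : j3 = j2 by apply: zJinj; [exact: QJ| |rewrite -E3].
    by move: j2Q; rewrite -E23 j3Q.
  move: E; rewrite /z'; case: ifPn => jQ; case: ifPn => j'Q.
  + exact: bJinj.
  + by move=> /cross[].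
  + by move=> E; case: (cross j' j).
  + exact: zJinj.
- move=> i iR ik; case: (split_row _ iR ik) => [->|[{}ik /negPf->]].
    by rewrite eqxx wcl; right; exists t; rewrite /z' tQ b_e.
  case: (last i iR ik) => [|[j [jC nej E]]]; [by left|right].
  have jJ : j \in J by apply/JP; split=> //; move: nej; rewrite z_e //; clear; lia.
  case: (boolP (j \in Q)) => jQ; last by exists j; rewrite /z' (negPf jQ).
  case: (zQ _ jQ) => [E'|[j' j'Q E']]; first by rewrite E' eqxx in nej.
  by exists j'; rewrite /z' j'Q b_e ?QC // E E'.
- move=> i j iR ik jC; case: (split_row _ iR ik) => [->|[{}ik /negPf->]]; last exact: above.
  rewrite eqxx rho0 => lt; have jcl : j != cl by apply: contraTneq lt => ->; rewrite kap_cl; clear; lia.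
  rewrite wC ?inC' //; case: ifPn => // /QJ/JP[_]; move: lt; clear; lia.
- move=> i j iR ik jC; case: (split_row _ iR ik) => [->|[{}ik /negPf->]]; last exact: diag.
  rewrite eqxx rho0 => E; have -> : j = j0 by apply: kap_inj => //; move: E kap0; clear; lia.
  by rewrite wC // j0Q.
Qed.

Lemma smetaniuk_rectangle : exists v : X -> Y -> K,
  [/\ forall i, i \in R :\ rl -> {in C &, injective (v i)},
      forall i j, i \in R :\ rl -> j \in C ->
        v i j = e \/ exists2 j', j' \in C :\ cl & v i j = b i j',
      forall j, j \in C -> {in R :\ rl &, injective (v^~ j)},
      forall i j, i \in R :\ rl -> j \in C :\ cl ->
        v i j = e \/ exists2 i', i' \in R :\ rl & v i j = b i' j
    & forall i j, i \in R :\ rl -> j \in C ->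
        (rho i + kap j < m.-1 -> v i j = b i j) /\ (rho i + kap j = m.-1 -> v i j = e)].
Proof.
have rl_lt i : i \in R :\ rl -> i \in R /\ rho i < m.-1.
  rewrite in_setD1 => /andP[irl iR]; split=> //.
  have : rho i != rho rl by apply: contraNneq irl => /rho_inj->.
  by rewrite rho_rl; case: rhoP => _ /(_ _ iR); rewrite -/m; lia.
have [m1|m1] := leqP m 1.
  have R0 i : i \in R :\ rl -> False by move=> /rl_lt[_]; lia.
  exists b; split=> [i /R0|i j /R0|j _ i i' /R0|i j /R0|i j /R0] //.
have [v [z [row row_val col col_val _ _ _ _ above diag]]] :
    exists v z, partial_rectangle m.-1 v z.
  have : 0 < m.-1 by lia.
  elim: {-2}m.-1 (leqnn m.-1) => // -[_ _ _|k IHk ltk _].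
    by do 2!eexists; apply: partial_rectangle1.
  have [||v [z P]] := IHk; [by lia|by []|].
  by apply: partial_rectangleS P; lia.
exists v; split.
- by move=> i /rl_lt[]; apply: row.
- by move=> i j /rl_lt[? ?]; apply: row_val.
- by move=> j jC i i' /rl_lt[? ?] /rl_lt[? ?]; apply: col.
- move=> i j /rl_lt[iR im] jC; have [_ [|[i' [i'R i'm E]]]] := col_val i j iR im jC.
    by left.
  by right; exists i' => //; apply: rowP.
- by move=> i j /rl_lt[? ?] jC; split=> E; [apply: above|apply: diag].
Qed.

End Rectangle.

Lemma in_inj_onto (T U : finType) (A : {set T}) (B : {set U}) (f : T -> U) :
  {in A &, injective f} -> {in A, forall x, f x \in B} -> #|B| <= #|A| ->
  forall y, y \in B -> exists2 x, x \in A & f x = y.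
Proof.
move=> fI fB leBA y yB.
have sub : f @: A \subset B by apply/subsetP => z /imsetP[x xA ->]; apply: fB.
have : f @: A == B by rewrite eqEcard sub card_in_imset.
by move/eqP=> E; move: yB; rewrite -E => /imsetP[x xA ->]; exists x.
Qed.

Lemma leq_card_rel (T U : finType) (A : {set T}) (B : {set U}) (r : T -> U -> bool) :
  (forall x, x \in A -> exists2 y, y \in B & r x y) ->
  (forall x x' y, x \in A -> x' \in A -> r x y -> r x' y -> x = x') ->
  #|A| <= #|B|.
Proof.
move=> ex uniq.
have [->|[a aA]] := set_0Vmem A; first by rewrite cards0.
have [y0 _ _] := ex a aA.
pose f x := odflt y0 [pick y in B | r x y].
have fP x : x \in A -> f x \in B /\ r x (f x).
  move=> /ex[y yB rxy]; rewrite /f; case: pickP => [z /andP[]//|/(_ y)].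
  by rewrite yB rxy.
have fI : {in A &, injective f}.
  move=> x x' xA x'A E; have [_ rx] := fP _ xA; have [_ rx'] := fP _ x'A.
  by apply: uniq rx _; rewrite ?E.
rewrite -(card_in_imset fI); apply: subset_leq_card.
by apply/subsetP => y /imsetP[x xA ->]; case: (fP _ xA).
Qed.

Lemma card_lt_notin (T : finType) (A B : {set T}) : #|B| < #|A| -> exists2 x, x \in A & x \notin B.
Proof.
move=> lt; apply/subsetPn; apply/negP => /subset_leq_card.
by rewrite leqNgt lt.
Qed.

Section Extension.
Variables (X Y K : finType) (R : {set X}) (C : {set Y}) (S : {set K}).
Variables (rho : X -> nat) (kap : Y -> nat) (rl : X) (cl : Y).
Variables (b : X -> Y -> K) (mr : X -> K) (mc : Y -> K) (e u : K).
Let m := #|R|.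
Let R' := R :\ rl.
Let C' := C :\ cl.
Hypotheses (cardRC : #|C| = #|R|) (cardS : #|S| = #|R|.+1).
Hypotheses (rhoP : ranking R rho) (kapP : ranking C kap).
Hypotheses (rlR : rl \in R) (clC : cl \in C) (rho_rl : rho rl = m.-1) (kap_cl : kap cl = m.-1).
Hypotheses (eS : e \in S) (uS : u \in S :\ e).
Hypothesis b_val : forall i j, i \in R' -> j \in C' -> b i j \in S :\ e.
Hypothesis b_row : forall i, i \in R' -> {in C' &, injective (b i)}.
Hypothesis b_col : forall j, j \in C' -> {in R' &, injective (b^~ j)}.
Hypothesis mrP : forall i, i \in R' -> mr i \in S :\ e /\ forall j, j \in C' -> b i j != mr i.
Hypothesis mcP : forall j, j \in C' -> mc j \in S :\ e /\ forall i, i \in R' -> b i j != mc j.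

Let cardR' : #|R'| = m.-1. Proof. by rewrite /m (cardsD1 rl R) rlR. Qed.
Let cardC' : #|C'| = m.-1. Proof. by rewrite /m -cardRC (cardsD1 cl C) clC. Qed.
Let m_gt0 : 0 < m. Proof. by rewrite card_gt0; apply/set0Pn; exists rl. Qed.
Let cardSe : #|S :\ e| = m. Proof. by move: cardS; rewrite (cardsD1 e S) eS -/m add1n => -[]. Qed.

Lemma missing_corner (v0 : X -> Y -> K) :
  (forall i j, i \in R' -> j \in C -> v0 i j = e \/ exists2 j', j' \in C' & v0 i j = b i j') ->
  exists t, [/\ t \in S :\ e, forall i, i \in R' -> v0 i cl != t
    & (forall i j, i \in R' -> j \in C' -> b i j != u) -> t = u].
Proof.
move=> v0_val.
case: (boolP [forall i in R', forall j in C', b i j != u]) => [|nall].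
  move=> /forall_inP nu; have {}nu i j : i \in R' -> j \in C' -> b i j != u.
    by move=> iR jC; have /forall_inP := nu i iR; apply.
  exists u; split=> // i iR; case: (v0_val i cl iR clC) => [->|[j jC ->]]; last exact: nu.
  by move: uS; rewrite in_setD1 eq_sym => /andP[].
have [|t tS tv] := @card_lt_notin _ (S :\ e) (v0^~ cl @: R').
  by rewrite cardSe; have := leq_imset_card (v0^~ cl) R'; rewrite cardR'; lia.
exists t; split=> // [i iR|nu].
  by apply: contraNneq tv => <-; apply: (imset_f (v0^~ cl)).
case/negP: nall; apply/forall_inP => i iR; apply/forall_inP => j jC; exact: nu.
Qed.

(* The last row gets in each column the colour still missing there. A colour [s] missing in [k] of
   the rows is missing in [k] of the columns of [b], hence absent from [k + 1] columns of the
   rectangle, so that it is needed only once in the last row. *)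
Lemma smetaniuk_extension : exists (v : X -> Y -> K) (t : K),
  [/\ [/\ forall i j, i \in R -> j \in C -> v i j \in S,
          forall i, i \in R -> {in C &, injective (v i)}
        & forall j, j \in C -> {in R &, injective (v^~ j)}],
      [/\ forall i j, i \in R' -> j \in C -> v i j != mr i,
          forall i j, i \in R -> j \in C' -> v i j != mc j,
          forall j, j \in C -> v rl j != t
        & forall i, i \in R -> v i cl != t],
      t \in S :\ e, (forall i j, i \in R' -> j \in C' -> b i j != u) -> t = u
    & forall i j, i \in R -> j \in C ->
        (rho i + kap j < m.-1 -> v i j = b i j) /\ (rho i + kap j = m.-1 -> v i j = e)].
Proof.
have b_e i j : i \in R' -> j \in C' -> b i j != e.
  by move=> iR jC; have := b_val iR jC; rewrite in_setD1 => /andP[].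
have [v0 [row row_val col col_val diag]] :=
  smetaniuk_rectangle cardRC rhoP kapP rlR clC rho_rl kap_cl b_row b_col b_e.
have [t [tS tcl tu]] := missing_corner row_val.
have S_e s : s \in S :\ e -> s \in S /\ s != e by rewrite in_setD1 => /andP[].
have inC' j : j \in C -> j != cl -> j \in C' by rewrite in_setD1 => -> ->.
have C'C j : j \in C' -> j \in C by rewrite in_setD1 => /andP[].
have v0_S i j : i \in R' -> j \in C -> v0 i j \in S.
  move=> iR jC; case: (row_val i j iR jC) => [->//|[j' j'C ->]].
  by case: (S_e _ (b_val iR j'C)).
have v0_mr i j : i \in R' -> j \in C -> v0 i j != mr i.
  move=> iR jC; have [mrS mrb] := mrP iR; case: (row_val i j iR jC) => [->|[j' j'C ->]].
    by rewrite eq_sym; case: (S_e _ mrS).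
  exact: mrb.
pose nc j := if j == cl then t else mc j.
have nc_S j : j \in C -> nc j \in S :\ e.
  by move=> jC; rewrite /nc; case: eqP => // /eqP jcl; case: (mcP (inC' _ jC jcl)).
have v0_nc i j : i \in R' -> j \in C -> v0 i j != nc j.
  move=> iR jC; rewrite /nc; case: (j =P cl) => [->|/eqP jcl]; first exact: tcl.
  have jC' := inC' _ jC jcl; have [mcS mcb] := mcP jC'.
  case: (col_val i j iR jC') => [->|[i' i'R ->]]; last exact: mcb.
  by rewrite eq_sym; case: (S_e _ mcS).
pose used j := nc j |: (v0^~ j @: R').
have used_card j : j \in C -> #|used j| = m.
  move=> jC; rewrite cardsU1 card_in_imset ?cardR'; last exact: col.
  have -> : nc j \notin v0^~ j @: R'.
    by apply/imsetP => -[i iR E]; have := v0_nc i j iR jC; rewrite E eqxx.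
  by rewrite add1n prednK.
have used_sub j : j \in C -> used j \subset S.
  move=> jC; apply/subsetP => s; rewrite in_setU1 => /predU1P[->|/imsetP[i iR ->]].
    by case: (S_e _ (nc_S _ jC)).
  exact: v0_S.
pose last j := odflt t [pick s in S :\: used j].
have last_eq j s : j \in C -> (s == last j) = (s \in S :\: used j).
  move=> jC; have : #|S :\: used j| == 1.
    by rewrite cardsD (setIidPr (used_sub _ jC)) cardS used_card // subSnn.
  case/cards1P=> s0 E; rewrite /last E; case: pickP => [s1|/(_ s0)]; last by rewrite set11.
  by rewrite !in_set1 => /eqP->.
have lastP j : j \in C -> last j \in S :\: used j by move=> jC; rewrite -last_eq.
pose miss s := [set j in C | [forall i in R', v0 i j != s]].
have missP s j : reflect (j \in C /\ forall i, i \in R' -> v0 i j != s) (j \in miss s).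
  by rewrite [j \in miss s]in_set; apply: (iffP andP) => -[jC /forall_inP].
have last_miss j : j \in C -> j \in miss (last j).
  move=> jC; apply/missP; split=> // i iR; have := lastP _ jC.
  rewrite in_setD in_setU1 negb_or => /andP[/andP[_ /imsetP nv] _].
  by apply/eqP => E; apply: nv; exists i.
have last_nc j : j \in C -> last j != nc j.
  by move=> /lastP; rewrite in_setD in_setU1 negb_or => /andP[/andP[]].
pose k s := #|[set i in R' | mr i == s]|.
have cardN s : #|[set i in R' | mr i != s]| + k s = m.-1.
  rewrite -cardR' -(cardsID [set i | mr i == s] R') addnC; congr (_ + _).
    by apply: eq_card => i; rewrite !inE.
  by apply: eq_card => i; rewrite !inE andbC.
have miss_card s : s \in S -> #|miss s| <= (k s).+1.
  move=> sS; have : #|[set i in R' | mr i != s]| <= #|C :\: miss s|.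
    apply: (@leq_card_rel _ _ _ _ (fun i j => (j \in C) && (v0 i j == s))) => [i|i i' j].
      case/setIdP=> iR mis.
      have [||||j jC E] := @in_inj_onto _ _ C (S :\ mr i) (v0 i) _ _ _ s.
      - exact: row.
      - by move=> j jC; rewrite in_setD1 v0_mr // v0_S.
      - have [/S_e[mrS _] _] := mrP iR.
        by move: cardS; rewrite (cardsD1 (mr i)) mrS cardRC add1n => -[->].
      - by rewrite in_setD1 sS eq_sym mis.
      exists j; rewrite ?jC ?E ?eqxx // in_setD jC andbT.
      by apply/negP => /missP[_ /(_ i iR)]; rewrite E eqxx.
    move=> /setIdP[iR _] /setIdP[i'R _] /andP[jC /eqP E] /andP[_ /eqP E'].
    by apply: (col j jC); rewrite // E.
  have : miss s \subset C by apply/subsetP => j /missP[].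
  move=> /setIidPr sub; have := cardN s; have := cardsID (miss s) C; rewrite sub cardRC -/m.
  by clear; lia.
pose fill s := [set j in C | nc j == s].
have fill_miss s : fill s \subset miss s.
  apply/subsetP => j /setIdP[jC /eqP <-]; apply/missP; split=> // i iR.
  exact: v0_nc.
have fill_card s : s \in S -> k s + (s == t) <= #|fill s|.
  move=> sS; have [->|se] := eqVneq s e.
    have -> : k e = 0.
      apply: eq_card0 => i; apply/negP => /setIdP[iR /eqP E].
      by have [/S_e[_]] := mrP iR; rewrite E eqxx.
    by rewrite eq_sym; case: (S_e _ tS) => _ /negPf->.
  have : #|[set j in C' | mc j != s]| <= #|[set i in R' | mr i != s]|.
    apply: (@leq_card_rel _ _ _ _ (fun j i => (i \in R') && (b i j == s))) => [j|j j' i].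
      case/setIdP=> jC mcs; have [mcS mcb] := mcP jC.
      have [||||i iR E] := @in_inj_onto _ _ R' (S :\ e :\ mc j) (b^~ j) _ _ _ s.
      - exact: b_col.
      - by move=> i iR; rewrite in_setD1 mcb // b_val.
      - by rewrite cardR'; move: cardSe; rewrite (cardsD1 (mc j)) mcS add1n => <-.
      - by rewrite !in_setD1 sS se eq_sym mcs.
      exists i; rewrite ?iR ?E ?eqxx // in_set iR; case: (mrP iR) => _ /(_ j jC).
      by rewrite E eq_sym.
    move=> /setIdP[jC _] /setIdP[j'C _] /andP[iR /eqP E] /andP[_ /eqP E'].
    by apply: (b_row iR); rewrite // E.
  have := cardN s.
  have : #|[set j in C' | mc j == s]| + #|[set j in C' | mc j != s]| = m.-1.
    rewrite -cardC' -(cardsID [set j | mc j == s] C'); congr (_ + _).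
      by apply: eq_card => j; rewrite !inE.
    by apply: eq_card => j; rewrite !inE andbC.
  have : #|[set j in C' | mc j == s]| + (s == t) <= #|fill s|.
    rewrite (cardsD1 cl (fill s)) addnC in_set clC /nc eqxx eq_sym leq_add2l.
    apply: subset_leq_card; apply/subsetP => j /setIdP[jC E].
    have /setD1P[jcl jC1] := jC.
    by rewrite in_setD1 jcl in_set jC1 /= /nc (negPf jcl).
  by clear; lia.
have excess s : s \in S -> #|miss s :\: fill s| + (s == t) <= 1.
  move=> sS; have := miss_card s sS; have := fill_card s sS.
  by have := cardsID (fill s) (miss s); rewrite (setIidPr (fill_miss s)); clear; lia.
have last_excess j : j \in C -> j \in miss (last j) :\: fill (last j).
  by move=> jC; rewrite in_setD last_miss // in_set jC eq_sym last_nc.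
have last_S j : j \in C -> last j \in S by move=> /lastP; rewrite in_setD => /andP[].
have last_inj : {in C &, injective last}.
  move=> j j' jC j'C E; apply/eqP; apply: contraT => jj'.
  have := excess _ (last_S _ jC); rewrite (cardsD1 j) last_excess //.
  by rewrite (cardsD1 j') in_setD1 eq_sym jj' E last_excess.
have last_t j : j \in C -> last j != t.
  move=> jC; apply/eqP => E; have := excess _ (last_S _ jC).
  by rewrite (cardsD1 j) last_excess // E eqxx; clear; lia.
have inR' i : i \in R -> i != rl -> i \in R' by rewrite in_setD1 => -> ->.
have R'rl i : i \in R' -> i != rl by rewrite in_setD1 => /andP[].
have last_v0 i j : i \in R' -> j \in C -> v0 i j != last j.
  by move=> iR jC; have /missP[_] := last_miss _ jC; apply.
exists (fun i j => if i == rl then last j else v0 i j), t; split=> //.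
- split=> [i j iR jC|i iR|j jC].
  + by case: eqP => [_|/eqP irl]; [apply: last_S|apply: v0_S => //; apply: inR'].
  + by case: eqP => [_|/eqP irl] //; apply: row; apply: inR'.
  + move=> i i' iR i'R; case: eqP => [->|/eqP irl]; case: eqP => [->|/eqP i'rl] //.
    * by move=> E; have := last_v0 _ _ (inR' _ i'R i'rl) jC; rewrite E eqxx.
    * by move=> E; have := last_v0 _ _ (inR' _ iR irl) jC; rewrite E eqxx.
    * by apply: col; rewrite ?inR'.
- split=> [i j iR jC|i j iR jC|j jC|i iR].
  + by rewrite (negPf (R'rl _ iR)) v0_mr.
  + have ncj : nc j = mc j by move: jC; rewrite in_setD1 /nc => /andP[/negPf->].
    by rewrite -ncj; case: (i =P rl) => [_|/eqP irl]; [apply: last_nc|apply: v0_nc]; rewrite ?inR' ?C'C.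
  + by rewrite eqxx last_t.
  + by case: (i =P rl) => [_|/eqP irl]; [apply: last_t|apply: tcl; apply: inR'].
move=> i j iR jC; case: eqP => [->|/eqP irl]; last exact: (diag i j (inR' _ iR irl) jC).
rewrite rho_rl; split; first by clear; lia.
move=> E; have kj : kap j = 0 by move: E; clear; lia.
symmetry; apply/eqP; rewrite last_eq // in_setD eS andbT in_setU1 negb_or eq_sym.
case: (S_e _ (nc_S _ jC)) => _ -> /=; apply/imsetP => -[i' i'R E'].
have i'R1 : i' \in R by move: i'R; rewrite in_setD1 => /andP[].
have [rI rlt _] := rhoP.
have rho_lt : rho i' < m.-1.
  have : rho i' != rho rl by apply: contraNneq (R'rl _ i'R) => /rI->.
  by have := rlt _ i'R1; rewrite rho_rl -/m; clear; lia.
have [j' j'C kj'] : exists2 j', j' \in C & kap j' = m.-1 - rho i'.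
  by apply: ranking_onto kapP _; rewrite cardRC -/m; move: rho_lt; clear; lia.
have [_ dg] := diag i' j' i'R j'C.
have jj' : j = j'.
  apply: (row i' i'R) => //; rewrite -E' dg // kj'; move: rho_lt; clear; lia.
by move: kj' rho_lt; rewrite -jj' kj; clear; lia.
Qed.

End Extension.

(** * Moving prescriptions above the diagonal *)

Lemma ranking_exists (T : finType) (A : {set T}) : exists r, ranking A r.
Proof.
exists (fun x => if x \in A then index x (enum A) else 0); split=> [x y xA yA|x xA|x /negPf->//].
  by rewrite xA yA => /index_inj-> //; rewrite mem_enum.
by rewrite xA cardE index_mem mem_enum.
Qed.

Lemma ranking_lt (T : finType) (A : {set T}) r x : ranking A r -> 0 < #|A| -> r x < #|A|.
Proof. by case=> _ rlt r0 ?; have [/rlt|/r0->] := boolP (x \in A). Qed.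

Lemma ranking_first (T : finType) (A : {set T}) (r : T -> nat) a :
  a \in A -> ranking (A :\ a) r ->
  ranking A (fun x => if x \in A :\ a then (r x).+1 else 0).
Proof.
move=> aA [rI rlt _]; have cA : #|A| = #|A :\ a|.+1 by rewrite (cardsD1 a A) aA.
split=> [x y xA yA|x xA|x xA].
- case: ifPn => xa; case: ifPn => ya //; first by case=> /rI->.
  move=> _; move: xa ya; by rewrite !in_setD1 xA yA !andbT !negbK => /eqP-> /eqP->.
- by case: ifPn => [/rlt|_]; rewrite cA.
- by rewrite in_setD1 (negPf xA) andbF.
Qed.

Lemma ranking_last (T : finType) (A : {set T}) (r : T -> nat) a :
  a \in A -> ranking (A :\ a) r ->
  ranking A (fun x => if x == a then #|A|.-1 else r x).
Proof.
move=> aA [rI rlt r0]; have cA : #|A| = #|A :\ a|.+1 by rewrite (cardsD1 a A) aA.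
have inA x : x \in A -> x != a -> x \in A :\ a by rewrite in_setD1 => -> ->.
split=> [x y xA yA|x xA|x xA].
- have [->|xa] := eqVneq x a; have [->|ya] := eqVneq y a => //.
  + by move=> E; have := rlt _ (inA _ yA ya); rewrite -E cA ltnn.
  + by move=> E; have := rlt _ (inA _ xA xa); rewrite E cA ltnn.
  + by apply: rI; apply: inA.
- by case: eqVneq => [_|xa]; [rewrite cA|rewrite cA ltnW // ltnS rlt ?inA].
- by case: eqP => [E|_]; [rewrite E aA in xA|rewrite r0 // in_setD1 (negPf xA) andbF].
Qed.

(* The prescriptions [D] lie strictly above the back diagonal [rho i + kap j = #|R|.-1]. *)
Definition placed (X Y : finType) (R : {set X}) (D : {set X * Y}) (rho : X -> nat) (kap : Y -> nat) :=
  forall p, p \in D -> rho p.1 + kap p.2 < #|R|.-1.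

Definition flip (X Y : finType) (p : X * Y) := (p.2, p.1).
Definition transpose (X Y : finType) (D : {set X * Y}) : {set Y * X} := @flip Y X @^-1: D.

Lemma in_tr (X Y : finType) (D : {set X * Y}) i j : ((j, i) \in transpose D) = ((i, j) \in D).
Proof. by rewrite inE. Qed.

Lemma card_tr (X Y : finType) (D : {set X * Y}) : #|transpose D| = #|D|.
Proof. by rewrite /transpose on_card_preimset //; exists (@flip X Y) => -[]. Qed.

Lemma peel_row (X Y : finType) (R : {set X}) (C : {set Y}) (D : {set X * Y}) i w rho kap :
  #|R| = #|C| -> 1 < #|R| -> i \in R -> w \in C -> (forall p, p \in D -> p.2 != w) ->
  ranking (R :\ i) rho -> ranking (C :\ w) kap ->
  placed (R :\ i) [set p in D | p.1 != i] rho kap ->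
  exists rho' kap', [/\ ranking R rho', ranking C kap', placed R D rho' kap',
    forall x, x \in R :\ i -> rho' x = (rho x).+1 & forall y, y \in C :\ w -> kap' y = kap y].
Proof.
move=> cRC R1 iR wC Dw rhoP kapP plD.
have cR : #|R| = #|R :\ i|.+1 by rewrite (cardsD1 i R) iR.
have cC : #|C| = #|C :\ w|.+1 by rewrite (cardsD1 w C) wC.
exists (fun x => if x \in R :\ i then (rho x).+1 else 0), (fun y => if y == w then #|C|.-1 else kap y).
split=> [|||x -> //|y /setD1P[/negPf-> //]]; [exact: ranking_first|exact: ranking_last|].
move=> p pD; rewrite (negPf (Dw p pD)); case: ifPn => pi; last first.
  have := ranking_lt p.2 kapP; rewrite cRC cC /=; apply.
  by move: R1; rewrite cRC cC.
have := plD p; rewrite in_set pD; case/setD1P: pi => -> _ /(_ isT).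
by rewrite cR /=; move: R1; rewrite cR; clear; lia.
Qed.

Lemma empty_column (X Y : finType) (C : {set Y}) (D : {set X * Y}) :
  #|D| < #|C| -> exists2 w, w \in C & forall p, p \in D -> p.2 != w.
Proof.
move=> lt; have [|w wC nw] := @card_lt_notin _ C (snd @: D).
  exact: leq_ltn_trans (leq_imset_card _ _) lt.
by exists w => // p pD; apply: contraNneq nw => <-; apply: imset_f.
Qed.

Lemma strict_placement_rows (X Y : finType) (R : {set X}) (C : {set Y}) (D : {set X * Y}) k :
  (forall (R' : {set X}) (C' : {set Y}) (D' : {set X * Y}), #|R'| <= k -> #|R'| = #|C'| ->
     (forall p, p \in D' -> p.1 \in R' \/ p.2 \in C') -> #|D'| <= #|R'|.-1 ->
     exists rho kap, [/\ ranking R' rho, ranking C' kap & placed R' D' rho kap]) ->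
  #|R| <= k.+1 -> #|R| = #|C| ->
  (forall p, p \in D -> p.1 \in R \/ p.2 \in C) -> #|D| <= #|R|.-1 ->
  (exists2 p, p \in D & p.1 \in R) ->
  exists rho kap, [/\ ranking R rho, ranking C kap & placed R D rho kap].
Proof.
move=> IH leR cRC inRC leD [p0 p0D p0R].
have D0 : 0 < #|D| by rewrite card_gt0; apply/set0Pn; exists p0.
have R1 : 1 < #|R| by move: leD D0; clear; lia.
have [|w wC Dw] := @empty_column _ _ C D; first by rewrite -cRC; move: leD R1; clear; lia.
have cR : #|R| = #|R :\ p0.1|.+1 by rewrite (cardsD1 p0.1 R) p0R.
have cC : #|C| = #|C :\ w|.+1 by rewrite (cardsD1 w C) wC.
have [|||| rho [kap [rhoP kapP pl]]] := IH (R :\ p0.1) (C :\ w) [set p in D | p.1 != p0.1].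
- by rewrite cR ltnS in leR.
- by move: cRC; rewrite cR cC => -[].
- move=> p /setIdP[pD pi]; case: (inRC p pD) => [pR|pC]; [left|right].
    by rewrite in_setD1 pi.
  by rewrite in_setD1 Dw.
- have : [set p in D | p.1 != p0.1] \subset D :\ p0.
    apply/subsetP => p /setIdP[pD pi]; rewrite in_setD1 pD andbT.
    by apply: contraNneq pi => ->.
  by move=> /subset_leq_card; move: leD; rewrite (cardsD1 p0 D) p0D cR; clear; lia.
have [rho' [kap' [? ? ? _ _]]] := peel_row cRC R1 p0R wC Dw rhoP kapP pl.
by exists rho', kap'.
Qed.

Lemma placed_tr (X Y : finType) (R : {set X}) (C : {set Y}) (D : {set X * Y}) rho kap :
  #|R| = #|C| -> placed C (transpose D) kap rho -> placed R D rho kap.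
Proof. by move=> cRC pl [i j] ijD; have := pl (j, i); rewrite in_tr cRC /= addnC; apply. Qed.

Lemma strict_placement (X Y : finType) (R : {set X}) (C : {set Y}) (D : {set X * Y}) :
  #|R| = #|C| -> (forall p, p \in D -> p.1 \in R \/ p.2 \in C) -> #|D| <= #|R|.-1 ->
  exists rho kap, [/\ ranking R rho, ranking C kap & placed R D rho kap].
Proof.
have [k leR] := ubnP #|R|; elim: k => // k IHk in X Y R C D leR *.
move=> cRC inRC leD.
have [->|[p0 p0D]] := set_0Vmem D.
  have [rho rhoP] := ranking_exists R; have [kap kapP] := ranking_exists C.
  by exists rho, kap; split=> // p; rewrite inE.
case: (inRC p0 p0D) => [p0R|p0C].
  case: k => [|k] in IHk leR *.
    by move: leR; rewrite ltnS leqn0 cards_eq0 => /eqP E; rewrite E inE in p0R.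
  apply: (strict_placement_rows (k := k)) => //; last by exists p0.
  by move=> R' C' D' leR'; apply: IHk; rewrite ltnS.
case: k => [|k] in IHk leR *.
  by move: leR; rewrite cRC ltnS leqn0 cards_eq0 => /eqP E; rewrite E inE in p0C.
have [||||||rho [kap [? ? pl]]] := @strict_placement_rows Y X C R (transpose D) k.
- by move=> R' C' D' leR'; apply: IHk; rewrite ltnS.
- by rewrite -cRC.
- by [].
- by move=> [j i]; rewrite in_tr => /inRC[]; [right|left].
- by rewrite card_tr -cRC.
- by exists (p0.2, p0.1) => //; rewrite in_tr -surjective_pairing.
by exists kap, rho; split=> //; apply: placed_tr pl.
Qed.

Definition diagonal_placement (X Y : finType) (R : {set X}) (C : {set Y}) (D : {set X * Y}) x y :=
  exists rho kap, [/\ ranking R rho, ranking C kap, placed R D rho kap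
                    & rho x + kap y = #|R|.-1].

Lemma diagonal_placement_tr (X Y : finType) (R : {set X}) (C : {set Y}) (D : {set X * Y}) x y :
  #|R| = #|C| -> diagonal_placement C R (transpose D) y x -> diagonal_placement R C D x y.
Proof.
move=> cRC [kap [rho [kapP rhoP pl E]]]; exists rho, kap; split=> //.
  exact: placed_tr pl.
by rewrite addnC E cRC.
Qed.

Section DiagonalPlacement.
Variables (X Y : finType) (R : {set X}) (C : {set Y}) (D : {set X * Y}) (x : X) (y : Y).
Hypotheses (cRC : #|R| = #|C|) (xR : x \in R) (yC : y \in C) (nD : (x, y) \notin D).
Hypothesis inRC : forall p, p \in D -> p.1 \in R \/ p.2 \in C.

Let cR : #|R| = #|R :\ x|.+1. Proof. by rewrite (cardsD1 x R) xR. Qed.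
Let cC : #|C| = #|C :\ y|.+1. Proof. by rewrite (cardsD1 y C) yC. Qed.
Let cRC' : #|R :\ x| = #|C :\ y|. Proof. by move: cRC; rewrite cR cC => -[]. Qed.

Lemma diagonal_placement_row_free :
  (forall p, p \in D -> p.1 != x) -> #|[set p in D | p.2 \in C]| <= #|R|.-2 ->
  diagonal_placement R C D x y.
Proof.
move=> Dx leD; set D' := [set p in D | p.2 \in C :\ y].
have [||rho [kap [rhoP kapP pl]]] := @strict_placement _ _ (R :\ x) (C :\ y) D' cRC'.
- by move=> p /setIdP[]; right.
- rewrite cR in leD; apply: leq_trans leD; apply: subset_leq_card.
  by apply/subsetP => p /setIdP[pD /setD1P[_ pC]]; rewrite in_set pD.
exists (fun z => if z == x then #|R|.-1 else rho z).
exists (fun z => if z \in C :\ y then (kap z).+1 else 0).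
split; [exact: ranking_last|exact: ranking_first| |]; last first.
  by rewrite eqxx in_setD1 eqxx addn0.
move=> p pD; rewrite (negPf (Dx p pD)); case: ifPn => py.
  by have := pl p; rewrite in_set pD py => /(_ isT); rewrite cR; clear; lia.
rewrite addn0 cR /=; apply: ranking_lt rhoP _.
have [pC|npC] := boolP (p.2 \in C); last first.
  rewrite card_gt0; apply/set0Pn; exists p.1; rewrite in_setD1 Dx //.
  by case: (inRC pD) => // pC; rewrite pC in npC.
have : 0 < #|[set p in D | p.2 \in C]| by rewrite card_gt0; apply/set0Pn; exists p; rewrite in_set pD.
by move: leD; rewrite cR; clear; lia.
Qed.

Lemma diagonal_placement_col_free : #|D| <= #|R|.-1 ->
  (exists2 p, p \in D & p.1 = x) -> (forall p, p \in D -> p.2 != y) ->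
  diagonal_placement R C D x y.
Proof.
move=> leD [p0 p0D p0x] Dy; set D' := [set p in D | p.1 != x].
have ltD : #|D'| < #|D|.
  rewrite (cardsD1 p0 D) p0D add1n ltnS; apply: subset_leq_card; apply/subsetP => p /setIdP[pD px].
  by rewrite in_setD1 pD andbT; apply: contraNneq px => ->; rewrite p0x.
have R1 : 1 < #|R| by move: leD ltD; clear; lia.
have [||rho [kap [rhoP kapP pl]]] := @strict_placement _ _ (R :\ x) (C :\ y) D' cRC'.
- move=> p /setIdP[pD px]; case: (inRC pD) => [pR|pC]; [left|right].
    by rewrite in_setD1 px.
  by rewrite in_setD1 Dy.
- by rewrite cR in leD R1; move: leD ltD R1; clear; lia.
exists (fun z => if z \in R :\ x then (rho z).+1 else 0).
exists (fun z => if z == y then #|C|.-1 else kap z).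
split; [exact: ranking_first|exact: ranking_last| |]; last first.
  by rewrite eqxx in_setD1 eqxx cRC.
move=> p pD; rewrite (negPf (Dy p pD)); case: ifPn => px.
  case/setD1P: px => px _.
  by have := pl p; rewrite in_set pD px => /(_ isT); rewrite cR; clear; lia.
have := ranking_lt p.2 kapP; rewrite cRC cC /=; apply.
by move: R1; rewrite cRC cC.
Qed.

End DiagonalPlacement.

Definition diagonal_placement_upto k := forall (X Y : finType) (R : {set X}) (C : {set Y})
    (D : {set X * Y}) x y,
  #|R| <= k -> #|R| = #|C| -> x \in R -> y \in C -> (x, y) \notin D ->
  (forall p, p \in D -> p.1 \in R \/ p.2 \in C) -> #|D| <= #|R|.-1 ->
  (exists2 p, p \in D & p.1 = x) \/ (exists2 p, p \in D & p.2 = y) ->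
  diagonal_placement R C D x y.

Lemma diagonal_placement_peel k (X Y : finType) (R : {set X}) (C : {set Y})
    (D : {set X * Y}) x y :
  diagonal_placement_upto k ->
  #|R| <= k.+1 -> #|R| = #|C| -> x \in R -> y \in C -> (x, y) \notin D ->
  (forall p, p \in D -> p.1 \in R \/ p.2 \in C) -> #|D| <= #|R|.-1 ->
  (exists2 p, p \in D & p.1 = x) -> (exists2 p, p \in D & p.2 = y) ->
  (exists2 q, q \in D & q.1 \in R :\ x) -> diagonal_placement R C D x y.
Proof.
move=> IH leR cRC xR yC nD inRC leD [px pxD Ex] [py pyD Ey] [q qD /setD1P[qx qR]].
have R0 : 0 < #|R| by rewrite card_gt0; apply/set0Pn; exists x.
have D0 : 0 < #|D| by rewrite card_gt0; apply/set0Pn; exists px.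
have R1 : 1 < #|R| by move: leD D0; clear; lia.
have [|w wC Dw] := @empty_column _ _ C D; first by rewrite -cRC; move: leD R1; clear; lia.
have cR : #|R| = #|R :\ q.1|.+1 by rewrite (cardsD1 q.1 R) qR.
have cC : #|C| = #|C :\ w|.+1 by rewrite (cardsD1 w C) wC.
have xR' : x \in R :\ q.1 by rewrite in_setD1 xR eq_sym qx.
have yC' : y \in C :\ w by rewrite in_setD1 yC -Ey Dw.
have [|||||||| rho [kap [rhoP kapP pl E]]] :=
  IH X Y (R :\ q.1) (C :\ w) [set p in D | p.1 != q.1] x y.
- by rewrite cR ltnS in leR.
- by move: cRC; rewrite cR cC => -[].
- by [].
- by [].
- by rewrite in_set (negPf nD).
- move=> p /setIdP[pD pi]; case: (inRC p pD) => [pR|pC]; [left|right].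
    by rewrite in_setD1 pi.
  by rewrite in_setD1 Dw.
- have : [set p in D | p.1 != q.1] \subset D :\ q.
    apply/subsetP => p /setIdP[pD pi]; rewrite in_setD1 pD andbT.
    by apply: contraNneq pi => ->.
  by move=> /subset_leq_card; move: leD; rewrite (cardsD1 q D) qD cR; clear; lia.
- by left; exists px => //; rewrite in_set pxD Ex eq_sym.
have [rho' [kap' [? ? ? rhoE kapE]]] := peel_row cRC R1 qR wC Dw rhoP kapP pl.
exists rho', kap'; split=> //; rewrite rhoE // kapE // addSn E cR.
by move: R1; rewrite cR; clear; lia.
Qed.

Lemma diagonal_placement_touching k : diagonal_placement_upto k.
Proof.
elim: k => [|k IHk] X Y R C D x y leR cRC xR yC nD inRC leD touch.
  by move: leR; rewrite leqn0 cards_eq0 => /eqP E; rewrite E inE in xR.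
have nDt : (y, x) \notin transpose D by rewrite in_tr.
have inCR p : p \in transpose D -> p.1 \in C \/ p.2 \in R.
  by case: p => j i; rewrite in_tr => /inRC[]; [right|left].
have leDt : #|transpose D| <= #|C|.-1 by rewrite card_tr -cRC.
have [/exists_inP[px pxD /eqP Ex]|nx] := boolP [exists p in D, p.1 == x]; last first.
  apply: diagonal_placement_tr => //; apply: diagonal_placement_col_free => //.
    case: touch => -[[i j] pD /= E]; last by exists (j, i); rewrite ?in_tr.
    by case/negP: nx; apply/exists_inP; exists (i, j) => //=; rewrite E.
  move=> [j i]; rewrite in_tr => pD; apply: contraNneq nx => /= E.
  by apply/exists_inP; exists (i, j) => //=; rewrite E.
have [/exists_inP[py pyD /eqP Ey]|ny] := boolP [exists p in D, p.2 == y]; last first.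
  apply: diagonal_placement_col_free => //; first by exists px.
  by move=> p pD; apply: contraNneq ny => E; apply/exists_inP; exists p => //; rewrite E.
have [/exists_inP[q qD qR]|nr] := boolP [exists q in D, q.1 \in R :\ x].
  by apply: (diagonal_placement_peel IHk) => //; [exists px|exists py|exists q].
have [/exists_inP[[i j] qD qC]|nc] := boolP [exists q in D, q.2 \in C :\ y].
  apply: diagonal_placement_tr => //; apply: (diagonal_placement_peel IHk) => //.
  - by rewrite -cRC.
  - by exists (py.2, py.1); rewrite ?in_tr -?surjective_pairing.
  - by exists (px.2, px.1); rewrite ?in_tr -?surjective_pairing.
  - by exists (j, i); rewrite ?in_tr.
have xy : px != py.
  by apply: contraNneq nD => E; rewrite -Ex -Ey -E -surjective_pairing.
have D2 : 1 < #|D|.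
  by rewrite (cardsD1 px) pxD (cardsD1 py) in_setD1 eq_sym xy pyD.
have cRx : #|R| = #|R :\ x|.+1 by rewrite (cardsD1 x R) xR.
have cCy : #|C| = #|C :\ y|.+1 by rewrite (cardsD1 y C) yC.
have /set0Pn[v /setD1P[vx vR]] : R :\ x != set0 by rewrite -card_gt0; move: leD D2 cRx; clear; lia.
have /set0Pn[w /setD1P[wy wC]] : C :\ y != set0 by rewrite -card_gt0; move: leD D2 cRC cCy; clear; lia.
have xRv : x \in R :\ v by rewrite in_setD1 eq_sym vx.
have yCw : y \in C :\ w by rewrite in_setD1 eq_sym wy.
have [r0 r0P] := ranking_exists (R :\ v :\ x).
have [c0 c0P] := ranking_exists (C :\ w :\ y).
have cCw : #|C| = #|C :\ w|.+1 by rewrite (cardsD1 w C) wC.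
do 2!eexists; split.
- exact: ranking_first vR (ranking_first xRv r0P).
- exact: ranking_last wC (ranking_last yCw c0P).
- move=> p pD /=; have := inRC p pD.
  have [pR|pR] := boolP (p.1 \in R); have [pC|pC] := boolP (p.2 \in C); last by case.
  + have Epx : p.1 = x.
      apply/eqP; apply: contraNT nr => px1; apply/exists_inP; exists p => //.
      by rewrite in_setD1 px1.
    have Epy : p.2 = y.
      apply/eqP; apply: contraNT nc => py1; apply/exists_inP; exists p => //.
      by rewrite in_setD1 py1.
    by case/negP: nD; rewrite -Epx -Epy -surjective_pairing.
  + have Epx : p.1 = x.
      apply/eqP; apply: contraNT nr => px1; apply/exists_inP; exists p => //.
      by rewrite in_setD1 px1.
    have [_ _ c00] := ranking_last wC (ranking_last yCw c0P).
    by rewrite (c00 _ pC) Epx xRv in_setD1 eqxx /= => _; move: leD D2; clear; lia.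
  + have Epy : p.2 = y.
      apply/eqP; apply: contraNT nc => py1; apply/exists_inP; exists p => //.
      by rewrite in_setD1 py1.
    have [_ _ r00] := ranking_first vR (ranking_first xRv r0P).
    by rewrite (r00 _ pR) Epy eq_sym (negPf wy) eqxx => _; move: leD D2 cRC cCw; clear; lia.
rewrite /= xRv in_setD1 eqxx /= eq_sym (negPf wy) eqxx; move: leD D2 cRC cCw; clear; lia.
Qed.

Lemma diagonal_placement_exists (X Y : finType) (R : {set X}) (C : {set Y})
    (D : {set X * Y}) x y :
  #|R| = #|C| -> x \in R -> y \in C -> (x, y) \notin D ->
  (forall p, p \in D -> p.1 \in R \/ p.2 \in C) -> #|D| <= #|R|.-1 ->
  #|D| <= #|R|.-2 \/ (exists2 p, p \in D & p.1 \notin R \/ p.2 \notin C) ->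
  diagonal_placement R C D x y.
Proof.
move=> cRC xR yC nD inRC leD slack.
have [/exists_inP[p pD /eqP E]|nx] := boolP [exists p in D, p.1 == x].
  by apply: (@diagonal_placement_touching #|R|) => //; left; exists p.
have [/exists_inP[p pD /eqP E]|ny] := boolP [exists p in D, p.2 == y].
  by apply: (@diagonal_placement_touching #|R|) => //; right; exists p.
have Dx p : p \in D -> p.1 != x.
  by move=> pD; apply: contraNneq nx => E; apply/exists_inP; exists p => //; rewrite E.
have Dy p : p \in D -> p.2 != y.
  by move=> pD; apply: contraNneq ny => E; apply/exists_inP; exists p => //; rewrite E.
have ltD (P : pred (X * Y)) p : p \in D -> ~~ P p -> #|[set p in D | P p]| < #|D|.
  move=> pD nP; apply: proper_card; apply/properP; split.
    by apply/subsetP => q /setIdP[].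
  by exists p => //; rewrite in_set pD.
have leP (P : pred (X * Y)) : #|[set p in D | P p]| <= #|D|.
  by apply: subset_leq_card; apply/subsetP => q /setIdP[].
case: slack => [leD2|[p pD [pR|pC]]].
- by apply: diagonal_placement_row_free => //; apply: leq_trans (leP _) leD2.
- apply: diagonal_placement_tr => //; apply: diagonal_placement_row_free => //.
  + by move=> [j i]; rewrite in_tr => /inRC[]; [right|left].
  + by move=> [j i]; rewrite in_tr => /Dy.
  + rewrite -cRC; have -> : [set p in transpose D | p.2 \in R] = transpose [set p in D | p.1 \in R].
      by apply/setP => -[j i]; rewrite !inE.
    by rewrite card_tr; have := ltD (fun p => p.1 \in R) p pD pR; move: leD; clear; lia.
- apply: diagonal_placement_row_free => //; have := ltD (fun p => p.2 \in C) p pD pC.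
  by move: leD; clear; lia.
Qed.

(** * Evans' conjecture *)

Lemma regular_hall (X Y : finType) (R B : {set X}) (G : X -> {set Y}) d :
  0 < d -> (forall i, i \in R -> d <= #|G i|) ->
  (forall j, #|[set i in R | j \in G i]| <= d) ->
  B \subset R -> #|B| <= #|\bigcup_(i in B) G i|.
Proof.
move=> d0 rowd cold sBR; set N := \bigcup_(i in B) G i.
rewrite -(leq_pmul2r d0).
have step1 : #|B| * d <= \sum_(i in B) \sum_(j in N) (j \in G i).
  rewrite -sum_nat_const; apply: leq_sum => i iB.
  apply: leq_trans (rowd i (subsetP sBR _ iB)) _.
  rewrite -sum1_card big_mkcond [leqRHS]big_mkcond; apply: leq_sum => j _ /=.
  case: ifP => // jG; suff -> : j \in N by [].
  by apply/bigcupP; exists i.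
apply: leq_trans step1 _; rewrite exchange_big -sum_nat_const; apply: leq_sum => j _.
apply: leq_trans (cold j); rewrite -sum1_card big_mkcond [leqRHS]big_mkcond.
apply: leq_sum => i _ /=; case: ifP => // iB; rewrite in_set (subsetP sBR _ iB).
by case: (j \in G i).
Qed.

Definition latin (X Y K : finType) (R : {set X}) (C : {set Y}) (S : {set K}) (L : X -> Y -> K) :=
  [/\ forall i j, i \in R -> j \in C -> L i j \in S,
      forall i, i \in R -> {in C &, injective (L i)}
    & forall j, j \in C -> {in R &, injective (L^~ j)}].

(* Pairs outside [R] (resp. [C]) lie on a border, where a colour may be repeated. *)
Definition partial_latin (X Y K : finType) (R : {set X}) (C : {set Y}) (D : {set X * Y})
    (phi : X * Y -> K) :=
  forall p q, p \in D -> q \in D -> p != q -> phi p = phi q ->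
  (p.1 = q.1 -> p.1 \notin R) /\ (p.2 = q.2 -> p.2 \notin C).

Definition completes (X Y K : finType) (D : {set X * Y}) (phi : X * Y -> K) (L : X -> Y -> K) :=
  forall p, p \in D -> L p.1 p.2 = phi p.

Section RepeatedColours.
Variables (X Y K : finType) (R : {set X}) (C : {set Y}) (S : {set K}).
Variables (D : {set X * Y}) (phi : X * Y -> K).
Hypotheses (cRC : #|C| = #|R|) (cRS : #|S| = #|R|) (R_gt0 : 0 < #|R|).
Hypothesis DRC : forall p, p \in D -> p.1 \in R /\ p.2 \in C.
Hypothesis phiS : forall p, p \in D -> phi p \in S.
Hypothesis phiP : partial_latin R C D phi.
Hypothesis leD : #|D| <= #|R|.
Hypothesis repeated : forall p, p \in D -> exists q, [/\ q \in D, q != p & phi q = phi p].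

Let used := phi @: D.

Lemma repeated_count s : s \in used -> #|[set p in D | phi p == s]| + 2 * #|used|.-1 <= #|R|.
Proof.
move=> sU; apply: leq_trans leD.
have -> : #|D| = \sum_(s' in used) #|[set p in D | phi p == s']|.
  rewrite -sum1_card (partition_big phi (mem used)) => [|p pD]; last exact: imset_f.
  apply: eq_bigr => s' _; rewrite -sum1_card; apply: eq_bigl => p.
  by rewrite [RHS]in_set.
rewrite (bigD1 s) //= leq_add2l.
have -> : 2 * #|used|.-1 = \sum_(s' in used | s' != s) 2.
  rewrite (eq_bigl (mem (used :\ s))) => [|s']; last by rewrite /= in_setD1 andbC.
  by rewrite sum_nat_const mulnC (cardsD1 s used) sU.
apply: leq_sum => s' /andP[/imsetP[p pD ->] _].
have [q [qD qp Eq]] := repeated pD.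
rewrite (cardsD1 p) (cardsD1 q).
by rewrite !inE pD qD qp Eq !eqxx.
Qed.

(* [N s i] is the column of colour [s] in row [i]. *)
Record partial_classes (P : {set K}) (N : K -> X -> Y) : Prop := PartialClasses {
  pc_val : forall s i, s \in P -> i \in R -> N s i \in C;
  pc_inj : forall s, s \in P -> {in R &, injective (N s)};
  pc_disj : forall s s' i, s \in P -> s' \in P -> i \in R -> N s i = N s' i -> s = s';
  pc_ext : forall p, p \in D -> phi p \in P -> N (phi p) p.1 = p.2;
  pc_avoid : forall s p, s \in P -> p \in D -> N s p.1 = p.2 -> phi p = s }.

Let same_row i j j' : (i, j) \in D -> (i, j') \in D -> phi (i, j) = phi (i, j') -> j = j'.
Proof.
move=> jD j'D E; apply/eqP; apply: contraT => jj'.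
have [|nR _] := phiP jD j'D _ E; first by apply: contraNneq jj' => -[->].
by have [iR _] := DRC jD; have := nR erefl; rewrite iR.
Qed.

Let same_col i i' j : (i, j) \in D -> (i', j) \in D -> phi (i, j) = phi (i', j) -> i = i'.
Proof.
move=> iD i'D E; apply/eqP; apply: contraT => ii'.
have [|_ nC] := phiP iD i'D _ E; first by apply: contraNneq ii' => -[->].
by have [_ jC] := DRC iD; have := nC erefl; rewrite jC.
Qed.

Let y0_exists : exists y : Y, true.
Proof. by move: R_gt0; rewrite -cRC => /card_gt0P[y _]; exists y. Qed.

Lemma partial_classes_extend (P : {set K}) N s (R0 : {set X}) (C0 : {set Y}) :
  s \notin P -> partial_classes P N ->
  R0 = R :\: fst @: [set p in D | phi p == s] ->
  C0 = C :\: snd @: [set p in D | phi p == s] ->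
  (forall B : {set X}, B \subset R0 -> #|B| <= #|\bigcup_(i in B)
     [set j in C0 | ((i, j) \notin D) && [forall s' in P, N s' i != j]]|) ->
  exists N', partial_classes (s |: P) N'.
Proof.
move=> sP [val inj disj ext avoid] ER0 EC0 hallR.
have [y0 _] := y0_exists.
have [f [fG fI]] := hall y0 hallR.
have fP i : i \in R0 ->
    [/\ f i \in C0, (i, f i) \notin D & forall s', s' \in P -> N s' i != f i].
  by move=> /fG; rewrite in_set => /and3P[? ? /forall_inP ?].
pose g i := if [pick j | ((i, j) \in D) && (phi (i, j) == s)] is Some j then j else f i.
have gP i : i \in R -> (i \in R0 /\ g i = f i) \/ ((i, g i) \in D /\ phi (i, g i) = s).
  move=> iR; rewrite /g; case: pickP => [j /andP[jD /eqP Ej]|nj]; [by right|left; split=> //].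
  rewrite ER0 in_setD iR andbT; apply/imsetP => -[[i' j] /setIdP[jD Ej] /= Ei].
  by have := nj j; rewrite Ei jD Ej.
have gD i j : (i, j) \in D -> phi (i, j) = s -> g i = j.
  move=> jD Ej; rewrite /g; case: pickP => [j' /andP[j'D /eqP Ej']|/(_ j)].
    by apply: same_row j'D jD _; rewrite Ej Ej'.
  by rewrite jD Ej eqxx.
have gC i : i \in R -> g i \in C.
  move=> /gP[[iR0 ->]|[/DRC[]] //].
  by have [] := fP i iR0; rewrite EC0 in_setD => /andP[].
have g_cross i i' : i' \in R0 -> (i, g i) \in D -> phi (i, g i) = s -> g i = f i' -> False.
  move=> i'R0 iD Ei E; have [] := fP _ i'R0; rewrite EC0 in_setD => /andP[/imsetP nC _] _ _.
  by apply: nC; exists (i, g i) => //; rewrite in_set iD Ei /=.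
have gI : {in R &, injective g}.
  move=> i i' iR i'R; case: (gP i iR) => [[iR0 ->]|[iD Ei]];
  case: (gP i' i'R) => [[i'R0 Ei'']|[i'D Ei']].
  - by rewrite Ei''; apply: fI.
  - by move=> /esym E; case: (g_cross i' i).
  - by rewrite Ei'' => E; case: (g_cross i i').
  - by move=> E; move: iD Ei; rewrite E => iD Ei; apply: same_col iD i'D _; rewrite Ei.
have g_disj s' i : s' \in P -> i \in R -> N s' i = g i -> False.
  move=> s'P iR; case: (gP i iR) => [[iR0 ->]|[iD Ei]] E.
    by have [_ _ /(_ s' s'P)] := fP _ iR0; rewrite E eqxx.
  by have := avoid s' (i, g i) s'P iD E; rewrite Ei => E'; rewrite E' s'P in sP.
have inP s' : s' \in s |: P -> s' != s -> s' \in P.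
  by rewrite in_setU1 => /predU1P[->|//]; rewrite eqxx.
exists (fun s' => if s' == s then g else N s'); split.
- move=> s' i s'P iR; case: eqP => [_|/eqP s's]; [exact: gC|].
  by apply: val => //; apply: inP.
- by move=> s' s'P; case: eqP => [_|/eqP s's] //; apply: inj; apply: inP.
- move=> s1 s2 i s1P s2P iR; case: eqP => [->|/eqP s1s]; case: eqP => [->|/eqP s2s] //.
  + by move=> /esym E; case: (g_disj s2 i) => //; apply: inP.
  + by move=> E; case: (g_disj s1 i) => //; apply: inP.
  + by apply: disj => //; apply: inP.
- move=> [i j] jD pP; case: eqP => [E|/eqP E]; first exact: gD.
  by apply: ext => //; apply: inP.
- move=> s' [i j] s'P jD; case: eqP => [->|/eqP E]; last by apply: avoid => //; apply: inP.
  have [iR _] := DRC jD; case: (gP i iR) => [[iR0 ->]|[iD Ei]] /= E; last by rewrite -E.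
  by have [_] := fP _ iR0; rewrite E jD.
Qed.

(* A violation [B], [C0 :\: NB] of Hall's condition has all its cells blocked, by distinct colours of
   [used :\ s] along each line; so both sides have at most [#|used| - 1] elements, whereas
   [repeated_count] gives room for [2 * (#|used| - 1)]. *)
Lemma partial_classes_used (P : {set K}) N s : P \subset used -> s \in used -> s \notin P ->
  partial_classes P N -> exists N', partial_classes (s |: P) N'.
Proof.
move=> sPU sU sP pc; have [val inj disj ext avoid] := pc.
set Ds := [set p in D | phi p == s].
apply: partial_classes_extend (sP) pc erefl erefl _ => B sB.
set R0 := R :\: fst @: Ds; set C0 := C :\: snd @: Ds.
set NB := \bigcup_(i in B) _.
have DsP i j : reflect ((i, j) \in D /\ phi (i, j) = s) ((i, j) \in Ds).
  by apply: (iffP setIdP) => -[? /eqP].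
have cR0 : #|R0| = #|R| - #|Ds|.
  rewrite cardsD (setIidPr _) ?card_in_imset //.
    move=> [i j] [i' j'] /DsP[jD Ej] /DsP[j'D Ej'] /= E; rewrite -{}E in j'D Ej' *.
    by congr (_, _); apply: same_row jD j'D _; rewrite Ej.
  by apply/subsetP => i /imsetP[[i' j] /DsP[/DRC[? _] _] ->].
have cC0 : #|C0| = #|R| - #|Ds|.
  rewrite cardsD (setIidPr _) ?card_in_imset ?cRC //.
    move=> [i j] [i' j'] /DsP[jD Ej] /DsP[j'D Ej'] /= E; rewrite -{}E in j'D Ej' *.
    by congr (_, _); apply: same_col jD j'D _; rewrite Ej.
  by apply/subsetP => j /imsetP[[i j'] /DsP[/DRC[_ ?] _] ->].
have BR0 i : i \in B -> i \in R /\ forall j, (i, j) \in D -> phi (i, j) != s.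
  move=> /(subsetP sB); rewrite in_setD => /andP[/imsetP nD iR]; split=> // j jD.
  by apply/eqP => E; apply: nD; exists (i, j) => //; apply/DsP.
rewrite leqNgt; apply/negP => ltNB.
have cV : #|R0| < #|B| + #|C0 :\: NB|.
  have : NB \subset C0 by apply/bigcupsP => i _; apply/subsetP => j /setIdP[].
  move=> /setIidPr sub; have := cardsID NB C0; rewrite sub cC0 cR0.
  by move: ltNB; clear; lia.
have blocked i j : i \in B -> j \in C0 :\: NB -> exists2 s', s' \in used :\ s &
    ((s' \in P) && (N s' i == j)) || (((i, j) \in D) && (phi (i, j) == s')).
  move=> iB; rewrite in_setD => /andP[/bigcupP nNB jC0].
  have [jD|jD] := boolP ((i, j) \in D).
    exists (phi (i, j)); last by rewrite eqxx orbT.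
    by have [_ /(_ j jD) ns] := BR0 _ iB; rewrite in_setD1 ns imset_f.
  have [ok|] := boolP [forall s' in P, N s' i != j].
    by case: nNB; exists i => //; rewrite in_set jC0 jD ok.
  move=> /forall_inPn[s' s'P]; rewrite negbK => /eqP E; exists s'; last by rewrite s'P E eqxx.
  by rewrite in_setD1 (subsetP sPU) // andbT; apply: contraNneq sP => <-.
have rows i : i \in B -> #|C0 :\: NB| <= #|used :\ s|.
  move=> iB; have [iR _] := BR0 _ iB; apply: (leq_card_rel (r := fun j s' =>
    ((s' \in P) && (N s' i == j)) || (((i, j) \in D) && (phi (i, j) == s')))).
    by move=> j jV; apply: blocked.
  move=> j j' s' _ _ /orP[/andP[s'P /eqP Ej]|/andP[jD /eqP Ej]]
    /orP[/andP[s'P' /eqP Ej']|/andP[j'D /eqP Ej']].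
  - by rewrite -Ej -Ej'.
  - by rewrite -Ej -Ej'; apply: (ext (i, j')); rewrite ?Ej'.
  - by rewrite -Ej' -Ej; apply/esym/(ext (i, j)); rewrite ?Ej.
  - by apply: same_row jD j'D _; rewrite Ej.
have cols j : j \in C0 :\: NB -> #|B| <= #|used :\ s|.
  move=> jV; apply: (leq_card_rel (r := fun i s' =>
    ((s' \in P) && (N s' i == j)) || (((i, j) \in D) && (phi (i, j) == s')))).
    by move=> i iB; apply: blocked.
  move=> i i' s' /BR0[iR _] /BR0[i'R _] /orP[/andP[s'P /eqP Ei]|/andP[iD /eqP Ei]]
    /orP[/andP[s'P' /eqP Ei']|/andP[i'D /eqP Ei']].
  - by apply: (inj s' s'P) => //; rewrite Ei.
  - apply: (inj s' s'P) => //; rewrite Ei -Ei'.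
    by apply/esym/(ext (i', j)); rewrite ?Ei'.
  - apply: (inj s' s'P') => //; rewrite Ei' -Ei.
    by apply/(ext (i, j)); rewrite ?Ei.
  - by apply: same_col iD i'D _; rewrite Ei.
have /card_gt0P[i iB] : 0 < #|B| by move: ltNB; clear; lia.
have /card_gt0P[j jV] : 0 < #|C0 :\: NB|.
  by have := subset_leq_card sB; rewrite -/Ds -/R0; move: cV; clear; lia.
have := rows i iB; have := cols j jV; have := repeated_count sU; rewrite -/Ds.
have : #|used| = #|used :\ s|.+1 by rewrite (cardsD1 s used) sU.
by move: cV; rewrite cR0; clear; lia.
Qed.

Lemma partial_classes_unused (P : {set K}) N s : P \subset S -> used \subset P ->
  s \in S -> s \notin P -> partial_classes P N -> exists N', partial_classes (s |: P) N'.
Proof.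
move=> sPS sUP sS sP pc; have [val inj disj ext avoid] := pc.
have D0 : [set p in D | phi p == s] = set0.
  apply/setP => p; rewrite in_set in_set0; apply/negP => /andP[pD /eqP E].
  by case/negP: sP; rewrite -E (subsetP sUP) ?imset_f.
apply: partial_classes_extend (sP) pc erefl erefl _ => B.
rewrite D0 !imset0 !setD0 => sB.
have ltP : #|P| < #|R|.
  rewrite -cRS; apply: proper_card; apply/properP; split=> //; by exists s.
apply: (@regular_hall _ _ R B _ (#|R| - #|P|)) sB; first by rewrite subn_gt0.
- move=> i iR; set G := [set j in C | _].
  have sub : C :\: [set N s' i | s' in P] \subset G.
    apply/subsetP => j; rewrite in_setD => /andP[nN jC]; rewrite in_set jC /=.
    apply/andP; split.
      apply: contraNN nN => jD; apply/imsetP; exists (phi (i, j)).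
        by rewrite (subsetP sUP) ?imset_f.
      by rewrite (ext (i, j)) // (subsetP sUP) ?imset_f.
    by apply/forall_inP => s' s'P; apply: contraNneq nN => <-; apply: imset_f.
  apply: leq_trans (subset_leq_card sub); rewrite cardsD cRC leq_sub2l //.
  by apply: leq_trans (subset_leq_card (subsetIr _ _)) (leq_imset_card _ _).
move=> j; set H := [set i in R | _].
have [jC|jC] := boolP (j \in C); last first.
  suff -> : H = set0 by rewrite cards0.
  apply/setP => i; rewrite in_set0; apply/negP => /setIdP[_].
  by rewrite in_set (negPf jC).
have : #|P| <= #|R :\: H|.
  apply: (leq_card_rel (r := fun s' i => (i \in R) && (N s' i == j))) => [s' s'P|s1 s2 i s1P s2P].
    have [||||i iR E] := @in_inj_onto _ _ R C (N s') _ _ _ j.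
    - exact: inj.
    - by move=> i iR; apply: val.
    - by rewrite cRC.
    - by [].
    exists i; last by rewrite iR E eqxx.
    rewrite in_setD iR andbT; apply/negP => /setIdP[_]; rewrite in_set => /and3P[_ _].
    by move=> /forall_inP/(_ s' s'P); rewrite E eqxx.
  by move=> /andP[iR /eqP E1] /andP[_ /eqP E2]; apply: (disj _ _ i) => //; rewrite E1.
have sHR : H \subset R by apply/subsetP => i /setIdP[].
have := cardsID H R; rewrite (setIidPr sHR); clear; lia.
Qed.

Lemma repeated_colours_completion : exists L, latin R C S L /\ completes D phi L.
Proof.
have [y0 _] := y0_exists.
have sUS : used \subset S by apply/subsetP => s /imsetP[p /phiS ? ->].
have pc0 : partial_classes set0 (fun _ _ => y0) by split=> s; rewrite ?inE // => ? ?; rewrite inE.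
have stage1 (Q : {set K}) : Q \subset used -> exists N, partial_classes Q N.
  have [k] := ubnP #|Q|; elim: k Q => // k IH Q leQ sQ.
  have [->|[s sinQ]] := set_0Vmem Q; first by exists (fun _ _ => y0).
  have [||N pc] := IH (Q :\ s).
  - by move: leQ; rewrite (cardsD1 s Q) sinQ.
  - exact: subset_trans (subsetDl _ _) sQ.
  rewrite -(setD1K sinQ); apply: partial_classes_used pc; last by rewrite in_setD1 eqxx.
    exact: subset_trans (subsetDl _ _) sQ.
  exact: (subsetP sQ).
have stage2 (Q : {set K}) : Q \subset S :\: used -> exists N, partial_classes (Q :|: used) N.
  have [k] := ubnP #|Q|; elim: k Q => // k IH Q leQ sQ.
  have [->|[s sinQ]] := set_0Vmem Q; first by rewrite set0U; apply: stage1.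
  have [||N pc] := IH (Q :\ s).
  - by move: leQ; rewrite (cardsD1 s Q) sinQ.
  - exact: subset_trans (subsetDl _ _) sQ.
  have := subsetP sQ _ sinQ; rewrite in_setD => /andP[sU sS].
  rewrite -(setD1K sinQ) -setUA; apply: partial_classes_unused pc => //.
  - rewrite subUset sUS andbT; apply: subset_trans (subsetDl _ _) (subset_trans sQ (subsetDl _ _)).
  - exact: subsetUr.
  - by rewrite in_setU in_setD1 eqxx negb_or sU.
have [|N] := stage2 (S :\: used); first by [].
have -> : S :\: used :|: used = S.
  by apply/setP => s; rewrite !inE; case: (boolP (s \in used)) => [/(subsetP sUS)->|]; rewrite ?orbF.
move=> [val inj disj ext avoid].
have /card_gt0P[s0 s0S] : 0 < #|S| by rewrite cRS.
pose L i j := odflt s0 [pick s in S | N s i == j].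
have LP i j : i \in R -> j \in C -> L i j \in S /\ N (L i j) i = j.
  move=> iR jC; rewrite /L; case: pickP => [s /andP[sS /eqP]//|none].
  have [||||s sS E] := @in_inj_onto _ _ S C (N^~ i) _ _ _ j.
  - by move=> s s' sS s'S; apply: disj.
  - by move=> s sS; apply: val.
  - by rewrite cRC cRS.
  - by [].
  by have := none s; rewrite sS E eqxx.
exists L; split; last first.
  move=> [i j] jD; have [iR jC] := DRC jD; have [LS E] := LP i j iR jC.
  by apply: (disj _ _ i) => //; [exact: phiS|rewrite /= E (ext (i, j)) // phiS].
split=> [i j iR jC|i iR j j' jC j'C E|j jC i i' iR i'R E].
- by case: (LP i j iR jC).
- by have [_ <-] := LP i j iR jC; rewrite E; case: (LP i j' iR j'C).
- have [LS Ei] := LP i j iR jC; have [_ Ei'] := LP i' j i'R jC.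
  by apply: (inj _ LS) => //; rewrite Ei E Ei'.
Qed.

End RepeatedColours.

Lemma evans (X Y K : finType) (R : {set X}) (C : {set Y}) (S : {set K})
    (D : {set X * Y}) (phi : X * Y -> K) (u : K) :
  #|C| = #|R| -> #|S| = #|R| -> u \notin S ->
  (forall p, p \in D -> p.1 \in R /\ p.2 \in C) -> (forall p, p \in D -> phi p \in S) ->
  partial_latin R C D phi -> #|D| < #|R| ->
  exists L, latin R C S L /\ completes D phi L.
Proof.
have [k leR] := ubnP #|R|; elim: k => // k IHk in R C S D leR *.
move=> cRC cRS uS DRC phiS phiP ltD.
have [/forall_inP rep|] := boolP [forall p in D, [exists q in D, (q != p) && (phi q == phi p)]].
  apply: repeated_colours_completion => //; [by apply: leq_ltn_trans ltD|exact: ltnW|].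
  by move=> p /rep/exists_inP[q qD /andP[qp /eqP E]]; exists q.
move=> /forall_inPn[[x y] xyD /exists_inPn once].
have {}once p : p \in D -> p != (x, y) -> phi p != phi (x, y).
  by move=> pD pxy; have := once p pD; rewrite pxy.
set e := phi (x, y) in once *; set D' := D :\ (x, y).
have [/= xR yC] := DRC _ xyD.
have eS : e \in S := phiS _ xyD.
have cD : #|D| = #|D'|.+1 by rewrite (cardsD1 (x, y) D) xyD.
have D'D p : p \in D' -> p \in D /\ phi p != e.
  by move=> /setD1P[pxy pD]; rewrite once.
have [||||||| rho [kap [rhoP kapP pl diag]]] := @diagonal_placement_exists _ _ R C D' x y.
- by rewrite cRC.
- by [].
- by [].
- by rewrite in_setD1 eqxx.
- by move=> p /D'D[/DRC[]]; left.
- by move: ltD; rewrite cD; clear; lia.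
- by left; move: ltD; rewrite cD; clear; lia.
have [rl rlR rho_rl] : exists2 i, i \in R & rho i = #|R|.-1.
  by apply: ranking_onto => //; move: ltD; clear; lia.
have [cl clC kap_cl] : exists2 j, j \in C & kap j = #|R|.-1.
  by apply: ranking_onto => //; rewrite cRC; move: ltD; clear; lia.
have inRC' p : p \in D' -> p.1 \in R :\ rl /\ p.2 \in C :\ cl.
  move=> pD'; have [/DRC[pR pC] _] := D'D _ pD'; have lt := pl _ pD'.
  split; rewrite in_setD1 ?pR ?pC andbT; apply: contraTneq lt => ->; rewrite -leqNgt.
    by rewrite rho_rl leq_addr.
  by rewrite kap_cl leq_addl.
have cR' : #|R| = #|R :\ rl|.+1 by rewrite (cardsD1 rl R) rlR.
have cC' : #|C| = #|C :\ cl|.+1 by rewrite (cardsD1 cl C) clC.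
have cS' : #|S| = #|S :\ e|.+1 by rewrite (cardsD1 e S) eS.
have [||||||||b [[bS brow bcol] bD']] := IHk (R :\ rl) (C :\ cl) (S :\ e) D'.
- by rewrite cR' ltnS in leR.
- by move: cRC; rewrite cR' cC' => -[].
- by move: cRS; rewrite cR' cS' => -[].
- by rewrite in_setD1 (negPf uS) andbF.
- exact: inRC'.
- by move=> p /D'D[pD pe]; rewrite in_setD1 pe phiS.
- move=> p q pD' qD' pq E; have [pR pC] := inRC' _ pD'.
  have [[pD _] [qD _]] := (D'D _ pD', D'D _ qD').
  have [nR nC] := phiP p q pD qD pq E.
  by split=> [/nR|/nC]; [case/setD1P: pR => _ ->|case/setD1P: pC => _ ->].
- by move: ltD; rewrite cD cR' ltnS.
have ue : u != e by apply: contraNneq uS => ->.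
have bu i j : i \in R :\ rl -> j \in C :\ cl -> b i j != u.
  move=> iR jC; have := bS i j iR jC; rewrite in_setD1 => /andP[_ bijS].
  by apply: contraNneq uS => <-.
have [||||||v [t [[vS vrow vcol] [vmr _ vrl _] _ tu vpl]]] :=
  @smetaniuk_extension _ _ _ R C (u |: S) rho kap rl cl b (fun=> u) (fun=> u) e u
    cRC _ rhoP kapP rlR clC rho_rl kap_cl _ _ _ brow bcol.
- by rewrite cardsU1 uS cRS.
- by rewrite in_setU1 eS orbT.
- by rewrite in_setD1 ue setU11.
- move=> i j iR jC; have := bS i j iR jC; rewrite !in_setD1 => /andP[-> bijS].
  by rewrite in_setU1 bijS orbT.
- by move=> i iR; split=> [|j jC]; [rewrite in_setD1 ue setU11|apply: bu].
- by move=> j jC; split=> [|i iR]; [rewrite in_setD1 ue setU11|apply: bu].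
exists v; split; first split=> //.
  move=> i j iR jC; have := vS i j iR jC; rewrite in_setU1 => /predU1P[E|//].
  have [Ei|irl] := eqVneq i rl; first by have := vrl j jC; rewrite (tu bu) -Ei E eqxx.
  by have := vmr i j; rewrite in_setD1 irl iR E eqxx => /(_ isT jC).
move=> p pD; have [->|pxy] := eqVneq p (x, y).
  by have [_] := vpl x y xR yC; rewrite -diag; apply.
have pD' : p \in D' by rewrite in_setD1 pxy.
have [pR pC] := DRC _ pD; have [E _] := vpl _ _ pR pC.
by rewrite E; [apply: bD'|apply: pl].
Qed.

(** * Bordered Latin squares *)

Lemma recoloured_line_inj (Y K : finType) (C : {set Y}) (o : Y) (c : K) (f f' : Y -> K)
    (w : option Y) :
  o \notin C -> {in C &, injective f} -> (forall y, y \in C -> f y != c) ->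
  (forall y, w = Some y -> y \in C) ->
  (forall y, y \in C -> f' y = if w == Some y then c else f y) ->
  f' o = (if w is Some y then f y else c) -> {in o |: C &, injective f'}.
Proof.
move=> oC fI fc wC f'C f'o.
have oP y : y \in C -> f' o = f' y -> False.
  move=> yC; rewrite f'o f'C //; case Ew: w => [z|]; last by move=> /= E; have := fc y yC; rewrite -E eqxx.
  have zC : z \in C by apply: wC.
  case: eqP => [_ E|nzy /fI E]; first by have := fc z zC; rewrite E eqxx.
  by apply: nzy; rewrite E.
move=> y y'; rewrite !in_setU1 => /predU1P[->|yC] /predU1P[->|y'C] //.
- by move=> /oP[].
- by move=> /esym/oP[].
rewrite !f'C //; have [Ew|_] := eqVneq w (Some y); have [Ew'|_] := eqVneq w (Some y').
- by move=> _; move: Ew'; rewrite Ew => -[].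
- by move=> E; have := fc y' y'C; rewrite -E eqxx.
- by move=> E; have := fc y yC; rewrite E eqxx.
- exact: fI.
Qed.

Section Bordered.
Variables (X Y K : finType) (ox : X) (oy : Y).

(* [B i oy] and [B ox j] are the colours missing at row [i] and column [j]; the corner [B ox oy]
   is meaningless. *)
Definition bordered_latin (R : {set X}) (C : {set Y}) (S : {set K}) (B : X -> Y -> K) :=
  [/\ forall i j, i \in R -> j \in oy |: C -> B i j \in S,
      forall i j, i \in ox |: R -> j \in C -> B i j \in S,
      forall i, i \in R -> {in oy |: C &, injective (B i)}
    & forall j, j \in C -> {in ox |: R &, injective (B^~ j)}].

Definition in_frame (R : {set X}) (C : {set Y}) (p : X * Y) :=
  [&& p.1 \in ox |: R, p.2 \in oy |: C & (p.1 \in R) || (p.2 \in C)].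

Definition on_border (R : {set X}) (C : {set Y}) (p : X * Y) := (p.1 \notin R) || (p.2 \notin C).

(* [g] moves a prescription on a border line to a cell of that line which lies in a
   column (or row) containing no prescription of [D]. *)
Record inward (R : {set X}) (C : {set Y}) (D : {set X * Y}) (g : X * Y -> X * Y) : Prop := Inward {
  inward_in : forall p, p \in D -> on_border R C p -> (g p).1 \in R /\ (g p).2 \in C;
  inward_row : forall p, p \in D -> on_border R C p -> p.1 \in R ->
    (g p).1 = p.1 /\ forall q, q \in D -> q.2 != (g p).2;
  inward_col : forall p, p \in D -> on_border R C p -> p.2 \in C ->
    (g p).2 = p.2 /\ forall q, q \in D -> q.1 != (g p).1;
  inward_inj : forall p q, p \in D -> q \in D -> on_border R C p -> on_border R C q -> p != q ->
    (g p).1 != (g q).1 /\ (g p).2 != (g q).2 }.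

End Bordered.

Lemma fresh_columns (X Y : finType) (oy : Y) (R : {set X}) (C : {set Y}) (D : {set X * Y}) :
  oy \notin C -> #|D| <= #|C| ->
  exists J : X -> Y, [/\ {in [set i in R | (i, oy) \in D] &, injective J}
    & forall i, i \in R -> (i, oy) \in D -> J i \in C /\ forall q, q \in D -> q.2 != J i].
Proof.
move=> oC leD; set T := [set i in R | _].
pose O : {set X * Y} := [set p | p.2 == oy].
pose img : {set Y} := snd @: D; set F := C :\: img.
have leT : #|T| <= #|F|.
  have : #|T| <= #|D :&: O|.
    apply: (leq_card_rel (r := fun i p => p == (i, oy))) => [i /setIdP[_ iD]|i i' p _ _].
      by exists (i, oy); rewrite // !inE iD eqxx.
    by move=> /eqP-> /eqP[].
  have : #|C :&: img| <= #|D :\: O|.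
    apply: leq_trans (leq_imset_card snd _); apply: subset_leq_card; apply/subsetP => j.
    rewrite in_setI => /andP[jC /imsetP[p pD Ej]]; rewrite Ej; apply: imset_f.
    by rewrite !inE pD andbT; apply: contraNneq oC => <-; rewrite -Ej.
  have := cardsID O D; have := cardsID img C; rewrite -/F.
  by move: leD; clear; lia.
have [|J [JF JI]] := @hall X Y oy T (fun=> F).
  move=> B sB; have [->|[i iB]] := set_0Vmem B; first by rewrite cards0.
  apply: leq_trans (leq_trans (subset_leq_card sB) leT) (subset_leq_card _).
  by apply/subsetP => j jF; apply/bigcupP; exists i.
exists J; split=> // i iR iD; have := JF i; rewrite in_set iR iD => /(_ isT).
rewrite in_setD => /andP[nJ ->]; split=> // q qD.
by apply: contraNneq nJ => <-; apply: imset_f.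
Qed.

Lemma inward_exists (X Y : finType) (ox : X) (oy : Y) (R : {set X}) (C : {set Y})
    (D : {set X * Y}) :
  ox \notin R -> oy \notin C -> #|C| = #|R| -> #|D| <= #|R| ->
  (forall p, p \in D -> in_frame ox oy R C p) ->
  exists g, inward R C D g.
Proof.
move=> oR oC cRC leD DF.
have [|J [JI JP]] := @fresh_columns _ _ oy R C D oC; first by rewrite cRC.
have [|I [II IP]] := @fresh_columns _ _ ox C R (transpose D) oR; first by rewrite card_tr.
have border p : p \in D -> on_border R C p ->
    (exists2 i, i \in R & p = (i, oy)) \/ (exists2 j, j \in C & p = (ox, j)).
  case: p => i j pD; have /and3P[/=] := DF _ pD; rewrite /on_border !in_setU1 /=.
  case/predU1P=> [->|iR]; case/predU1P=> [->|jC]; rewrite ?(negPf oR) ?(negPf oC) //.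
  - by right; exists j.
  - by left; exists i.
  - by rewrite iR jC.
pose g p := if p.1 \in R then (p.1, J p.1) else (I p.2, p.2).
have JP' i j : i \in R -> (i, oy) \in D -> (j, J i) \notin D.
  by move=> iR iD; apply/negP => /(proj2 (JP i iR iD)); rewrite eqxx.
have IP1 j : j \in C -> (ox, j) \in D -> I j \in R /\ forall q, q \in D -> q.1 != I j.
  move=> jC jD; have [|IR nI] := IP j jC; first by rewrite in_tr.
  by split=> // -[i' j'] pD; apply: (nI (j', i')); rewrite in_tr.
exists g; split.
- move=> p pD /(border p pD)[[i iR E]|[j jC E]]; rewrite E in pD *; rewrite /g /=.
    by rewrite iR; case: (JP i iR pD).
  by rewrite (negPf oR); case: (IP1 j jC pD).
- move=> p pD pb pR; have [[i iR E]|[j jC E]] := border p pD pb; rewrite E in pD pR *.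
    by rewrite /g /= iR; case: (JP i iR pD).
  by rewrite (negPf oR) in pR.
- move=> p pD pb pC; have [[i iR E]|[j jC E]] := border p pD pb; rewrite E in pD pC *.
    by rewrite (negPf oC) in pC.
  by rewrite /g /= (negPf oR); case: (IP1 j jC pD).
move=> p q pD qD /(border p pD)[[i iR Ep]|[j jC Ep]] /(border q qD)[[i' i'R Eq]|[j' j'C Eq]];
  rewrite {}Ep {}Eq in pD qD *; rewrite /g /= ?iR ?i'R ?(negPf oR) /= => pq.
- have ii' : i != i' by apply: contraNneq pq => ->.
  by split=> //; apply: contraNneq ii' => /JI->; rewrite // in_set ?iR ?i'R.
- have [_ /(_ _ qD) /= nJ] := JP i iR pD; have [_ /(_ _ pD) /= nI] := IP1 j' j'C qD.
  by split=> //; rewrite eq_sym.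
- have [_ /(_ _ pD) /= nJ] := JP i' i'R qD; have [_ /(_ _ qD) /= nI] := IP1 j jC pD.
  by split=> //; rewrite eq_sym.
- have jj' : j != j' by apply: contraNneq pq => ->.
  by split=> //; apply: contraNneq jj' => /II->; rewrite // in_set in_tr ?jC ?j'C.
Qed.

Section Recolouring.
Variables (X Y K : finType) (ox : X) (oy : Y) (R : {set X}) (C : {set Y}) (S : {set K}).
Variables (D : {set X * Y}) (phi : X * Y -> K) (c : K) (g : X * Y -> X * Y).
Hypotheses (oR : ox \notin R) (oC : oy \notin C).
Hypothesis DF : forall p, p \in D -> in_frame ox oy R C p.
Hypothesis phiS : forall p, p \in D -> phi p \in S.
Hypothesis phiP : partial_latin R C D phi.
Hypothesis phic : forall p, p \in D -> ~~ on_border R C p -> phi p != c.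
Hypothesis gP : inward R C D g.

Let moved := [set p in D | on_border R C p && (phi p != c)].
Definition kept := [set p in D | ~~ on_border R C p || (phi p != c)].
Definition push p := if on_border R C p then g p else p.
Definition pushed := push @: kept.
Definition pushed_colour q := if [pick p in kept | push p == q] is Some p then phi p else c.

Let frameP p : p \in D -> [\/ ~~ on_border R C p /\ (p.1 \in R /\ p.2 \in C),
    on_border R C p /\ (p.1 \in R /\ p.2 = oy) | on_border R C p /\ (p.1 = ox /\ p.2 \in C)].
Proof.
move=> /DF/and3P[]; rewrite /on_border !in_setU1.
case/predU1P=> [->|pR] /predU1P[->|pC]; rewrite ?(negPf oR) ?(negPf oC) //= => _.
- by constructor 3.
- by constructor 2; rewrite orbT.
- by constructor 1; rewrite pR pC.
Qed.

Let push_disjoint p q : p \in D -> q \in D -> p != q -> phi p = phi q ->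
  (push p).1 != (push q).1 /\ (push p).2 != (push q).2.
Proof.
have half p1 q1 : p1 \in D -> q1 \in D -> p1 != q1 -> phi p1 = phi q1 ->
    on_border R C p1 -> ~~ on_border R C q1 ->
    (g p1).1 != q1.1 /\ (g p1).2 != q1.2.
  move=> pD qD pq E pb qb; have [nR nC] := phiP pD qD pq E.
  case: (frameP pD) => [[]|[_ [pR _]]|[_ [_ pC]]]; first by rewrite pb.
    have [-> nq] := inward_row gP pD pb pR; split; last by rewrite eq_sym nq.
    by apply/eqP => /nR; rewrite pR.
  have [-> nq] := inward_col gP pD pb pC; split; first by rewrite eq_sym nq.
  by apply/eqP => /nC; rewrite pC.
move=> pD qD pq E; rewrite /push; case: ifPn => pb; case: ifPn => qb.
- exact: (inward_inj gP).
- exact: half.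
- by rewrite ![p.1 == _]eq_sym ![p.2 == _]eq_sym; apply: half; rewrite // eq_sym.
- have [nR nC] := phiP pD qD pq E.
  case: (frameP pD) => [[_ [pR pC]]|[pb' _]|[pb' _]]; [|by rewrite pb' in pb|by rewrite pb' in pb].
  by split; apply/eqP; [move=> /nR; rewrite pR|move=> /nC; rewrite pC].
Qed.

Let push_inj : {in D &, injective push}.
Proof.
have half p q : p \in D -> q \in D -> on_border R C p -> g p = q -> False.
  move=> pD qD pb E; case: (frameP pD) => [[]|[_ [pR _]]|[_ [_ pC]]]; first by rewrite pb.
    by have [_ /(_ q qD)] := inward_row gP pD pb pR; rewrite E eqxx.
  by have [_ /(_ q qD)] := inward_col gP pD pb pC; rewrite E eqxx.
move=> p q pD qD; rewrite /push; case: ifPn => pb; case: ifPn => qb //.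
- move=> E; apply/eqP; apply: contraT => pq.
  by have [] := inward_inj gP pD qD pb qb pq; rewrite E eqxx.
- by move=> E; case: (half p q).
- by move=> /esym E; case: (half q p).
Qed.

Let kept_D p : p \in kept -> p \in D. Proof. by case/setIdP. Qed.

Let kept_c p : p \in kept -> phi p != c.
Proof. by case/setIdP=> pD /orP[/(phic pD)|]. Qed.

Lemma pushed_colourE p : p \in kept -> pushed_colour (push p) = phi p.
Proof.
move=> pk; rewrite /pushed_colour; case: pickP => [q /andP[qk /eqP E]|/(_ p)].
  by congr phi; apply: push_inj E; apply: kept_D.
by rewrite pk eqxx.
Qed.

Lemma pushed_in q : q \in pushed -> q.1 \in R /\ q.2 \in C.
Proof.
move=> /imsetP[p /kept_D pD ->]; rewrite /push; case: ifPn => pb.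
  exact: (inward_in gP).
by case: (frameP pD) => [[]//|[]|[]]; rewrite (negPf pb).
Qed.

Lemma pushed_colour_in q : q \in pushed -> pushed_colour q \in S :\ c.
Proof.
by move=> /imsetP[p pk ->]; rewrite pushed_colourE // in_setD1 kept_c // phiS // kept_D.
Qed.

Lemma card_pushed : #|pushed| = #|kept|.
Proof. by apply: card_in_imset => p q /kept_D pD /kept_D qD; apply: push_inj. Qed.

Lemma pushed_partial_latin : partial_latin R C pushed pushed_colour.
Proof.
move=> _ _ /imsetP[p pk ->] /imsetP[q qk ->] pq; rewrite !pushed_colourE // => E.
have [|n1 n2] := push_disjoint (kept_D pk) (kept_D qk) _ E.
  by apply: contraNneq pq => ->.
by split=> /eqP; [rewrite (negPf n1)|rewrite (negPf n2)].
Qed.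

Lemma pushed_repeated :
  (forall p, p \in D -> exists q, [/\ q \in D, q != p & phi q = phi p]) ->
  forall p, p \in pushed ->
    exists q, [/\ q \in pushed, q != p & pushed_colour q = pushed_colour p].
Proof.
move=> rep _ /imsetP[p pk ->]; have [q [qD qp E]] := rep p (kept_D pk).
have qk : q \in kept by rewrite in_set qD E kept_c // orbT.
exists (push q); rewrite !pushed_colourE //; split=> //; first exact: imset_f.
by apply: contraNneq qp => /push_inj->//; apply: kept_D.
Qed.

Lemma recolour_border (L : X -> Y -> K) : c \in S ->
  latin R C (S :\ c) L -> completes pushed pushed_colour L ->
  exists B, [/\ bordered_latin ox oy R C S B, completes D phi B,
    forall i, i \in R -> B i oy = if [pick p in moved | (g p).1 == i] is Some p then phi p else c
    & forall j, j \in C -> B ox j = if [pick p in moved | (g p).2 == j] is Some p then phi p else c].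
Proof.
move=> cS [LS Lrow Lcol] LD.
have movedP p : p \in moved -> [/\ p \in D, on_border R C p, phi p != c & p \in kept].
  by case/setIdP=> pD /andP[pb pc]; rewrite in_set pD pc orbT.
have Lg p : p \in moved -> L (g p).1 (g p).2 = phi p.
  move=> /movedP[pD pb pc pk]; have := LD (push p); rewrite pushed_colourE // /push pb; apply.
  by apply/imsetP; exists p; rewrite // /push pb.
have g1 p q : p \in moved -> q \in moved -> (g p).1 = (g q).1 -> p = q.
  move=> /movedP[pD pb _ _] /movedP[qD qb _ _] E; apply/eqP; apply: contraT => pq.
  by have [] := inward_inj gP pD qD pb qb pq; rewrite E eqxx.
have g2 p q : p \in moved -> q \in moved -> (g p).2 = (g q).2 -> p = q.
  move=> /movedP[pD pb _ _] /movedP[qD qb _ _] E; apply/eqP; apply: contraT => pq.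
  by have [] := inward_inj gP pD qD pb qb pq; rewrite E eqxx.
have gRC p : p \in moved -> (g p).1 \in R /\ (g p).2 \in C.
  by move=> /movedP[pD pb _ _]; apply: (inward_in gP).
have Lc i j : i \in R -> j \in C -> L i j \in S /\ L i j != c.
  by move=> iR jC; have := LS i j iR jC; rewrite in_setD1 => /andP[].
pose mr i := if [pick p in moved | (g p).1 == i] is Some p then phi p else c.
pose mc j := if [pick p in moved | (g p).2 == j] is Some p then phi p else c.
pose B i j := if i == ox then mc j else if j == oy then mr i else
  if (i, j) \in g @: moved then c else L i j.
have neR i : i \in R -> (i == ox) = false.
  by move=> iR; apply: contraNF oR => /eqP<-.
have neC j : j \in C -> (j == oy) = false.
  by move=> jC; apply: contraNF oC => /eqP<-.
have Bcell i j : i \in R -> j \in C -> B i j = if (i, j) \in g @: moved then c else L i j.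
  by move=> iR jC; rewrite /B neR ?neC.
have Brow i : i \in R -> B i oy = mr i by move=> iR; rewrite /B neR // eqxx.
have Bcol j : B ox j = mc j by rewrite /B eqxx.
have phi_moved p : p \in moved -> phi p \in S by move=> /movedP[/phiS].
have mrS i : mr i \in S by rewrite /mr; case: pickP => // p /andP[/phi_moved].
have mcS j : mc j \in S by rewrite /mc; case: pickP => // p /andP[/phi_moved].
have BS i j : i \in R -> j \in C -> B i j \in S.
  by move=> iR jC; rewrite Bcell //; case: ifP => // _; case: (Lc i j).
exists B; split; [| |by move=> i iR; rewrite Brow|by move=> j _; rewrite Bcol].
- split.
  + by move=> i j iR /setU1P[->|jC]; [rewrite Brow|apply: BS].
  + by move=> i j /setU1P[->|iR] jC; [rewrite Bcol|apply: BS].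
  + move=> i iR; set w := [pick p in moved | (g p).1 == i].
    apply: (recoloured_line_inj (c := c) (f := L i) (w := omap (fun p => (g p).2) w)) => //.
    * exact: Lrow.
    * by move=> j jC; case: (Lc i j).
    * by move=> j; rewrite /w; case: pickP => // p /andP[pm _] [<-]; case: (gRC p pm).
    * move=> j jC; rewrite Bcell //; congr (if _ then _ else _).
      apply/imsetP/eqP => [[p pm Ep]|].
        rewrite /w; case: pickP => [q /andP[qm /eqP Eq]|/(_ p)]; last by rewrite pm -Ep eqxx.
        by rewrite /= (g1 q p) -?Ep // Eq -Ep.
      rewrite /w; case: pickP => // p /andP[pm /eqP Ep] /= [Ej].
      by exists p => //; rewrite -Ep -Ej -surjective_pairing.
    * rewrite Brow // /mr -/w /w; case: pickP => //= p /andP[pm /eqP Ep].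
      by rewrite -Lg // Ep.
  + move=> j jC; set w := [pick p in moved | (g p).2 == j].
    apply: (recoloured_line_inj (c := c) (f := L^~ j) (w := omap (fun p => (g p).1) w)) => //.
    * exact: Lcol.
    * by move=> i iR; case: (Lc i j).
    * by move=> i; rewrite /w; case: pickP => // p /andP[pm _] [<-]; case: (gRC p pm).
    * move=> i iR; rewrite Bcell //; congr (if _ then _ else _).
      apply/imsetP/eqP => [[p pm Ep]|].
        rewrite /w; case: pickP => [q /andP[qm /eqP Eq]|/(_ p)]; last by rewrite pm -Ep eqxx.
        by rewrite /= (g2 q p) -?Ep // Eq -Ep.
      rewrite /w; case: pickP => // p /andP[pm /eqP Ep] /= [Ei].
      by exists p => //; rewrite -Ep -Ei -surjective_pairing.
    * rewrite Bcol /mc -/w /w; case: pickP => //= p /andP[pm /eqP Ep].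
      by rewrite -Lg // Ep.
move=> p pD; case: (frameP pD) => [[pb [pR pC]]|[pb [pR E]]|[pb [E pC]]].
- rewrite Bcell // -surjective_pairing; case: imsetP => [[q /movedP[qD qb _ _] E]|_].
    case: (frameP qD) => [[]|[_ [qR _]]|[_ [_ qC]]]; first by rewrite qb.
      by have [_ /(_ p pD)] := inward_row gP qD qb qR; rewrite E eqxx.
    by have [_ /(_ p pD)] := inward_col gP qD qb qC; rewrite E eqxx.
  have pk : p \in kept by rewrite in_set pD pb.
  have := LD (push p) (imset_f _ pk).
  by rewrite pushed_colourE // /push (negPf pb).
- have [g1p _] := inward_row gP pD pb pR; rewrite E Brow // /mr.
  case: pickP => [q /andP[qm /eqP Eq]|none].
    have [qD qb _ _] := movedP q qm; congr phi; apply/eqP; apply: contraT => qp.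
    by have [] := inward_inj gP qD pD qb pb qp; rewrite Eq g1p eqxx.
  by have := none p; rewrite in_set pD pb g1p eqxx andbT /= => /negbFE/eqP->.
- have [g2p _] := inward_col gP pD pb pC; rewrite E Bcol /mc.
  case: pickP => [q /andP[qm /eqP Eq]|none].
    have [qD qb _ _] := movedP q qm; congr phi; apply/eqP; apply: contraT => qp.
    by have [] := inward_inj gP qD pD qb pb qp; rewrite Eq g2p eqxx.
  by have := none p; rewrite in_set pD pb g2p eqxx andbT /= => /negbFE/eqP->.
Qed.

End Recolouring.

Lemma bordered_completion (X Y K : finType) (ox : X) (oy : Y) (R : {set X}) (C : {set Y})
    (S : {set K}) (D : {set X * Y}) (phi : X * Y -> K) (u : K) :
  ox \notin R -> oy \notin C -> #|C| = #|R| -> #|S| = #|R|.+1 -> u \notin S ->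
  (forall p, p \in D -> in_frame ox oy R C p) -> (forall p, p \in D -> phi p \in S) ->
  partial_latin R C D phi -> #|D| <= #|R| ->
  exists B, bordered_latin ox oy R C S B /\ completes D phi B.
Proof.
have [k leR] := ubnP #|R|; elim: k => // k IHk in R C S D leR *.
move=> oR oC cRC cRS uS DF phiS phiP leD.
have cSD c : c \in S -> #|S :\ c| = #|R|.
  by move=> cS; move: cRS; rewrite (cardsD1 c) cS => -[].
have [R0|R_gt0] := posnP #|R|.
  have noR i : (i \in R) = false by rewrite (cards0_eq R0) in_set0.
  have noC j : (j \in C) = false by move: cRC; rewrite R0 => /cards0_eq->; rewrite in_set0.
  exists (fun _ _ => u); split; first by split=> [i j|i j|i|j]; rewrite ?noR ?noC.
  by move=> p /DF/and3P[_ _]; rewrite noR noC.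
have [/forall_inP rep|] := boolP [forall p in D, [exists q in D, (q != p) && (phi q == phi p)]].
  have [|c cS cD] := @card_lt_notin _ S (phi @: D).
    by rewrite cRS ltnS; apply: leq_trans (leq_imset_card _ _) leD.
  have phic p : p \in D -> ~~ on_border R C p -> phi p != c.
    by move=> pD _; apply: contraNneq cD => <-; apply: imset_f.
  have [g gP] := inward_exists oR oC cRC leD DF.
  have [||||||||L [LP LD]] := @repeated_colours_completion _ _ _ R C (S :\ c)
    (pushed R C D phi c g) (pushed_colour R C D phi c g).
  - by [].
  - exact: cSD.
  - by [].
  - exact: (pushed_in (ox := ox) (oy := oy)).
  - exact: (pushed_colour_in (ox := ox) (oy := oy)).
  - exact: (pushed_partial_latin (ox := ox) (oy := oy)).
  - rewrite (card_pushed (ox := ox) (oy := oy)) //; apply: leq_trans leD.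
    by apply: subset_leq_card; apply/subsetP => p /setIdP[].
  - apply: (pushed_repeated (ox := ox) (oy := oy)) => // p /rep/exists_inP[q qD /andP[qp /eqP E]].
    by exists q.
  have [B [BP BD _ _]] := recolour_border oR oC DF phiS gP cS LP LD.
  by exists B.
move=> /forall_inPn[[x y] p0D /exists_inPn once].
have {}once p : p \in D -> p != (x, y) -> phi p != phi (x, y).
  by move=> pD pp0; have := once p pD; rewrite pp0.
set e := phi (x, y) in once *; have eS : e \in S := phiS _ p0D.
have [p0b|p0i] := boolP (on_border R C (x, y)).
  have phic p : p \in D -> ~~ on_border R C p -> phi p != e.
    by move=> pD pb; apply: once => //; apply: contraNneq pb => ->.
  have [g gP] := inward_exists oR oC cRC leD DF.
  have [|||||L [LP LD]] := @evans _ _ _ R C (S :\ e)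
    (pushed R C D phi e g) (pushed_colour R C D phi e g) e cRC (cSD e eS).
  - by rewrite in_setD1 eqxx.
  - exact: (pushed_in (ox := ox) (oy := oy)).
  - exact: (pushed_colour_in (ox := ox) (oy := oy)).
  - exact: (pushed_partial_latin (ox := ox) (oy := oy)).
  - rewrite (card_pushed (ox := ox) (oy := oy)) //; apply: leq_trans leD.
    apply: proper_card; apply/properP; split; first by apply/subsetP => p /setIdP[].
    by exists (x, y) => //; rewrite in_set p0b eqxx andbF.
  have [B [BP BD _ _]] := recolour_border oR oC DF phiS gP eS LP LD.
  by exists B.
have [/exists_inP[p1 p1D p1b]|nob] := boolP [exists p in D, on_border R C p]; last first.
  have DRC p : p \in D -> p.1 \in R /\ p.2 \in C.
    move=> pD; move/exists_inPn: nob => /(_ p pD).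
    by rewrite negb_or !negbK => /andP[].
  have [|||||||L [[LS Lrow Lcol] LD]] := @evans _ _ _ (ox |: R) (oy |: C) S D phi u.
  - by rewrite !cardsU1 oR oC cRC.
  - by rewrite cardsU1 oR cRS.
  - by [].
  - by move=> p /DRC[pR pC]; rewrite !in_setU1 pR pC !orbT.
  - by [].
  - move=> p q pD qD pq E; have [nR nC] := phiP p q pD qD pq E.
    by have [pR pC] := DRC p pD; split=> [/nR|/nC]; rewrite ?pR ?pC.
  - by rewrite cardsU1 oR.
  exists L; split=> //; split.
  - by move=> i j iR jC; apply: LS => //; apply: setU1r.
  - by move=> i j iR jC; apply: LS => //; apply: setU1r.
  - by move=> i iR; apply: Lrow; apply: setU1r.
  - by move=> j jC; apply: Lcol; apply: setU1r.
set D' := D :\ (x, y).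
have [xR yC] : x \in R /\ y \in C by move: p0i; rewrite negb_or !negbK => /andP[].
have cD : #|D| = #|D'|.+1 by rewrite (cardsD1 (x, y) D) p0D.
have D'D p : p \in D' -> p \in D /\ phi p != e.
  by move=> /setD1P[pxy pD]; rewrite once.
have [|||||||rho [kap [rhoP kapP pl diag]]] := @diagonal_placement_exists _ _ R C D' x y.
- by rewrite cRC.
- by [].
- by [].
- by rewrite in_setD1 eqxx.
- by move=> p /D'D[/DF/and3P[_ _ /orP]].
- by move: leD; rewrite cD; clear; lia.
- right; exists p1; last exact/orP.
  by rewrite in_setD1 p1D andbT; apply: contraTneq p1b => ->.
have [rl rlR rho_rl] : exists2 i, i \in R & rho i = #|R|.-1.
  by apply: ranking_onto => //; rewrite prednK.
have [cl clC kap_cl] : exists2 j, j \in C & kap j = #|R|.-1.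
  by apply: ranking_onto => //; rewrite cRC prednK.
have ne_rl p : p \in D' -> p.1 != rl.
  by move=> /pl lt; apply: contraTneq lt => ->; rewrite -leqNgt rho_rl leq_addr.
have ne_cl p : p \in D' -> p.2 != cl.
  by move=> /pl lt; apply: contraTneq lt => ->; rewrite -leqNgt kap_cl leq_addl.
have cR' : #|R| = #|R :\ rl|.+1 by rewrite (cardsD1 rl R) rlR.
have cC' : #|C| = #|C :\ cl|.+1 by rewrite (cardsD1 cl C) clC.
have [||||||||||B' [[BSr BSc Brow Bcol] BD']] := IHk (R :\ rl) (C :\ cl) (S :\ e) D'.
- by rewrite cR' ltnS in leR.
- by rewrite in_setD1 (negPf oR) andbF.
- by rewrite in_setD1 (negPf oC) andbF.
- by move: cRC; rewrite cR' cC' => -[].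
- by rewrite cSD.
- by rewrite in_setD1 (negPf uS) andbF.
- move=> p pD'; have [pD _] := D'D p pD'; have := DF p pD.
  by rewrite /in_frame !in_setU1 !in_setD1 ne_rl // ne_cl.
- by move=> p /D'D[pD pe]; rewrite in_setD1 pe phiS.
- move=> p q pD' qD' pq E; have [[pD _] [qD _]] := (D'D _ pD', D'D _ qD').
  have [nR nC] := phiP p q pD qD pq E.
  by split=> [/nR|/nC]; rewrite in_setD1 => /negPf->; rewrite andbF.
- by move: leD; rewrite cD cR' ltnS.
have inC' j : j \in C -> j != cl -> j \in C :\ cl by rewrite in_setD1 => -> ->.
have inR' i : i \in R -> i != rl -> i \in R :\ rl by rewrite in_setD1 => -> ->.
have /card_gt0P[w wS] : 0 < #|S :\ e| by rewrite cSD.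
have [|||||v [t [[vS vrow vcol] [vmr vmc vrl vcl] tS _ vpl]]] :=
  @smetaniuk_extension _ _ _ R C S rho kap rl cl B' (B'^~ oy) (B' ox) e w
    cRC cRS rhoP kapP rlR clC rho_rl kap_cl eS wS.
- by move=> i j iR jC; apply: BSr => //; apply: setU1r.
- by move=> i iR j j' jC j'C; apply: Brow => //; apply: setU1r.
- by move=> j jC i i' iR i'R; apply: Bcol => //; apply: setU1r.
- move=> i iR; split=> [|j jC]; first by apply: BSr => //; apply: setU11.
  apply/eqP => /(Brow i iR) E.
  have Ej : j = oy by apply: E; [apply: setU1r|apply: setU11].
  by move: jC; rewrite Ej in_setD1 (negPf oC) andbF.
- move=> j jC; split=> [|i iR]; first by apply: BSc => //; apply: setU11.
  apply/eqP => /(Bcol j jC) E.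
  have Ei : i = ox by apply: E; [apply: setU1r|apply: setU11].
  by move: iR; rewrite Ei in_setD1 (negPf oR) andbF.
pose B i j := if i == ox then (if j == cl then t else B' ox j) else
  if j == oy then (if i == rl then t else B' i oy) else v i j.
have neR i : i \in R -> (i == ox) = false by move=> iR; apply: contraNF oR => /eqP<-.
have neC j : j \in C -> (j == oy) = false by move=> jC; apply: contraNF oC => /eqP<-.
have Bcell i j : i \in R -> j \in C -> B i j = v i j by move=> iR jC; rewrite /B neR ?neC.
have Brl : B rl oy = t by rewrite /B neR // !eqxx.
have Bcl : B ox cl = t by rewrite /B !eqxx.
have Bro i : i \in R -> i != rl -> B i oy = B' i oy.
  by move=> iR /negPf irl; rewrite /B neR // eqxx irl.
have Bco j : j != cl -> B ox j = B' ox j by move=> /negPf jcl; rewrite /B eqxx jcl.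
have [tS1 _] : t \in S /\ t != e by move: tS; rewrite in_setD1 => /andP[].
have SeS s : s \in S :\ e -> s \in S by case/setD1P.
have Bo_row i j : i \in R -> j \in C -> B i oy = v i j -> False.
  move=> iR jC; have [->|irl] := eqVneq i rl.
    by rewrite Brl => E; have := vrl j jC; rewrite -E eqxx.
  by rewrite Bro // => E; have := vmr i j (inR' i iR irl) jC; rewrite -E eqxx.
have Bo_col i j : i \in R -> j \in C -> B ox j = v i j -> False.
  move=> iR jC; have [->|jcl] := eqVneq j cl.
    by rewrite Bcl => E; have := vcl i iR; rewrite -E eqxx.
  by rewrite Bco // => E; have := vmc i j iR (inC' j jC jcl); rewrite -E eqxx.
exists B; split; first split.
- move=> i j iR /setU1P[->|jC]; last by rewrite Bcell ?vS.
  have [->|irl] := eqVneq i rl; first by rewrite Brl.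
  by rewrite Bro //; apply/SeS/BSr; rewrite ?setU11 ?inR'.
- move=> i j /setU1P[->|iR] jC; last by rewrite Bcell ?vS.
  have [->|jcl] := eqVneq j cl; first by rewrite Bcl.
  by rewrite Bco //; apply/SeS/BSc; rewrite ?setU11 ?inC'.
- move=> i iR j j' /setU1P[->|jC] /setU1P[->|j'C] //; rewrite ?[B i j]Bcell ?[B i j']Bcell //.
  + by move=> /Bo_row[].
  + by move=> /esym/Bo_row[].
  + exact: vrow.
- move=> j jC i i' /setU1P[->|iR] /setU1P[->|i'R] //; rewrite ?[B i j]Bcell ?[B i' j]Bcell //.
  + by move=> /Bo_col[].
  + by move=> /esym/Bo_col[].
  + exact: vcol.
move=> p pD; have [->|pxy] := eqVneq p (x, y).
  by rewrite Bcell //; have [_] := vpl x y xR yC; rewrite -diag; apply.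
have pD' : p \in D' by rewrite in_setD1 pxy.
have irl := ne_rl _ pD'; have jcl := ne_cl _ pD'; have Ep := BD' p pD'.
have := DF p pD; rewrite /in_frame !in_setU1.
have [pR|pR] := boolP (p.1 \in R); have [pC|pC] := boolP (p.2 \in C); rewrite ?orbT ?orbF ?andbF //=.
- by move=> _; have [E _] := vpl _ _ pR pC; rewrite Bcell // E ?Ep //; apply: pl.
- by rewrite andbT => /eqP Eo; move: Ep; rewrite Eo Bro.
- by rewrite andbT => /eqP Eo; move: Ep; rewrite Eo Bco.
Qed.

(** * Two copies *)

Lemma inward_sub (X Y : finType) (R : {set X}) (C : {set Y}) (D D' : {set X * Y}) g :
  D' \subset D -> inward R C D g -> inward R C D' g.
Proof.
move=> /subsetP sub [gin grow gcol ginj]; split=> [p pD|p pD pb pR|p pD pb pC|p q pD qD].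
- by apply: gin; apply: sub.
- by have [-> h] := grow p (sub _ pD) pb pR; split=> // q /sub/h.
- by have [-> h] := gcol p (sub _ pD) pb pC; split=> // q /sub/h.
- by apply: ginj; apply: sub.
Qed.

Lemma two_layers (X Y K : finType) (ox : X) (oy : Y) (R : {set X}) (C : {set Y})
    (S : {set K}) (D0 D1 : {set X * Y}) (phi0 phi1 : X * Y -> K) (u : K) :
  ox \notin R -> oy \notin C -> #|C| = #|R| -> #|S| = #|R|.+1 -> u \notin S ->
  (forall p, p \in D0 -> in_frame ox oy R C p) -> (forall p, p \in D1 -> in_frame ox oy R C p) ->
  (forall p, p \in D0 -> phi0 p \in S) -> (forall p, p \in D1 -> phi1 p \in S) ->
  partial_latin R C D0 phi0 -> partial_latin R C D1 phi1 ->
  (forall p, on_border R C p -> (p \in D0) = (p \in D1)) ->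
  (forall p, on_border R C p -> phi0 p = phi1 p) ->
  #|D0| + #|[set p in D1 | ~~ on_border R C p]| <= #|R| ->
  exists B0 B1,
    [/\ bordered_latin ox oy R C S B0, bordered_latin ox oy R C S B1,
        completes D0 phi0 B0, completes D1 phi1 B1
      & (forall i, i \in R -> B0 i oy = B1 i oy) /\ (forall j, j \in C -> B0 ox j = B1 ox j)].
Proof.
move=> oR oC cRC cRS uS DF0 DF1 phiS0 phiS1 phiP0 phiP1 Db phib leD.
set I0 := [set p in D0 | ~~ on_border R C p]; set I1 := [set p in D1 | _] in leD.
set N := [set p in D0 | on_border R C p].
have cD0 : #|D0| = #|N| + #|I0|.
  rewrite -(cardsID [set p | on_border R C p] D0); congr (_ + _); apply: eq_card => p.
    by rewrite !inE.
  by rewrite !inE andbC.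
have cD1 : #|D1| = #|N| + #|I1|.
  rewrite -(cardsID [set p | on_border R C p] D1); congr (_ + _); apply: eq_card => p.
    by rewrite !inE andbC [RHS]andbC; case: (boolP (on_border R C p)) => //= /Db->.
  by rewrite !inE andbC.
have [I00|/set0Pn[p0 p0I]] := eqVneq I0 set0.
  have [|B [BP BD]] := bordered_completion oR oC cRC cRS uS DF1 phiS1 phiP1.
    by move: leD; rewrite cD0 cD1 I00 cards0; clear; lia.
  exists B, B; split=> // p pD; have [pb|pb] := boolP (on_border R C p).
    by rewrite BD -?Db // phib.
  by have : p \in I0; [rewrite in_set pD|rewrite I00 in_set0].
have [I10|/set0Pn[p1 p1I]] := eqVneq I1 set0.
  have [|B [BP BD]] := bordered_completion oR oC cRC cRS uS DF0 phiS0 phiP0.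
    by move: leD; clear; lia.
  exists B, B; split=> // p pD; have [pb|pb] := boolP (on_border R C p).
    by rewrite BD ?Db // phib.
  by have : p \in I1; [rewrite in_set pD|rewrite I10 in_set0].
have I0_gt0 : 0 < #|I0| by rewrite card_gt0; apply/set0Pn; exists p0.
have I1_gt0 : 0 < #|I1| by rewrite card_gt0; apply/set0Pn; exists p1.
have ltD0 : #|D0| < #|R| by move: leD; clear -I1_gt0; lia.
have ltD1 : #|D1| < #|R| by move: leD; rewrite cD0 cD1; clear -I0_gt0; lia.
have [|c cS cU] := @card_lt_notin _ S (phi0 @: D0 :|: phi1 @: I1).
  rewrite cRS ltnS; apply: leq_trans leD.
  apply: leq_trans (leq_add (leq_imset_card phi0 _) (leq_imset_card phi1 _)).
  by rewrite cardsU leq_subr.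
have phic0 p : p \in D0 -> phi0 p != c.
  by move=> pD; apply: contraNneq cU => <-; rewrite in_setU imset_f.
have phic1 p : p \in D1 -> phi1 p != c.
  move=> pD; have [pb|pb] := boolP (on_border R C p).
    by rewrite -phib // phic0 // Db.
  by apply: contraNneq cU => <-; rewrite in_setU orbC imset_f // in_set pD.
have [||g gP] := @inward_exists _ _ ox oy R C (D0 :|: D1) oR oC cRC.
- have -> : D0 :|: D1 = D0 :|: I1.
    apply/setP => p; rewrite !in_setU [p \in I1]in_set.
    by have [/Db->|] := boolP (on_border R C p); rewrite ?orbb ?andbT //= andbF orbF.
  by apply: leq_trans leD; rewrite cardsU leq_subr.
- by move=> p; rewrite in_setU => /orP[/DF0|/DF1].
have gP0 := inward_sub (subsetUl D0 D1) gP; have gP1 := inward_sub (subsetUr D0 D1) gP.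
have cSc : #|S :\ c| = #|R| by move: cRS; rewrite (cardsD1 c) cS => -[].
have layer (D : {set X * Y}) phi : (forall p, p \in D -> in_frame ox oy R C p) ->
    (forall p, p \in D -> phi p \in S) -> partial_latin R C D phi ->
    (forall p, p \in D -> phi p != c) -> inward R C D g -> #|D| < #|R| ->
    exists L, latin R C (S :\ c) L /\
      completes (pushed R C D phi c g) (pushed_colour R C D phi c g) L.
  move=> DF phiS phiP phic gD ltD.
  apply: (evans (u := c)) => //; first by rewrite in_setD1 eqxx.
  - exact: (pushed_in (ox := ox) (oy := oy)).
  - by apply: (pushed_colour_in (ox := ox) (oy := oy)) => // p pD _; apply: phic.
  - exact: (pushed_partial_latin (ox := ox) (oy := oy)).
  - rewrite (card_pushed (ox := ox) (oy := oy)) //; apply: leq_ltn_trans ltD.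
    by apply: subset_leq_card; apply/subsetP => p /setIdP[].
have [L0 [LP0 LD0]] := layer D0 phi0 DF0 phiS0 phiP0 phic0 gP0 ltD0.
have [L1 [LP1 LD1]] := layer D1 phi1 DF1 phiS1 phiP1 phic1 gP1 ltD1.
have [B0 [BP0 BD0 Br0 Bc0]] := recolour_border oR oC DF0 phiS0 gP0 cS LP0 LD0.
have [B1 [BP1 BD1 Br1 Bc1]] := recolour_border oR oC DF1 phiS1 gP1 cS LP1 LD1.
have movedE p : (p \in [set p in D0 | on_border R C p && (phi0 p != c)]) =
    (p \in [set p in D1 | on_border R C p && (phi1 p != c)]).
  rewrite [LHS]in_set [RHS]in_set; have [pb|] := boolP (on_border R C p); last by rewrite !andbF.
  by rewrite Db // phib.
have pickE (P : pred (X * Y)) :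
    (if [pick p in [set p in D0 | on_border R C p && (phi0 p != c)] | P p] is Some p
     then phi0 p else c) =
    (if [pick p in [set p in D1 | on_border R C p && (phi1 p != c)] | P p] is Some p
     then phi1 p else c).
  rewrite (eq_pick (Q := fun p =>
    (p \in [set p in D1 | on_border R C p && (phi1 p != c)]) && P p)).
    case: pickP => // p /andP[/setIdP[_ /andP[pb _]] _].
    exact: phib.
  by move=> p /=; rewrite movedE.
exists B0, B1; split=> //; split=> [i iR|j jC]; first by rewrite Br0 // Br1 // pickE.
by rewrite Bc0 // Bc1 // pickE.
Qed.

Section Prism.
Variable n : nat.
Local Notation G := ('K_(n, n) □ 'K_2).
Local Notation line := (option 'I_n).

(* Both copies of [K_{n,n}] are indexed by pairs (row, column); [None] stands for the border,
   i.e. for the edges joining the two copies, which do not depend on [t]. *)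
Definition prism_edge (t : 'I_2) (p : line * line) : {set G} :=
  [set v : G | match v.1 with
    | inl i => (p.1 == Some i) && ((p.2 == None) || (v.2 == t))
    | inr j => (p.2 == Some j) && ((p.1 == None) || (v.2 == t))
    end].

Lemma in_prism_edge_row t p i s :
  (((inl i, s) : G) \in prism_edge t p) = (p.1 == Some i) && ((p.2 == None) || (s == t)).
Proof. by rewrite inE. Qed.

Lemma in_prism_edge_col t p j s :
  (((inr j, s) : G) \in prism_edge t p) = (p.2 == Some j) && ((p.1 == None) || (s == t)).
Proof. by rewrite inE. Qed.

Lemma prism_edge_border t t' p : (p.1 == None) || (p.2 == None) ->
  prism_edge t p = prism_edge t' p.
Proof.
by case: p => [[i|] [j|]] //= _; apply/setP => -[[k|k] s]; rewrite !inE.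
Qed.

Lemma prism_edge_inj t t' p p' : p != (None, None) -> prism_edge t p = prism_edge t' p' ->
  p = p' /\ ((p.1 != None) && (p.2 != None) -> t = t').
Proof.
case: p p' => [a b] [a' b'] nN /setP E.
have rowE i s := E (inl i, s); have colE j s := E (inr j, s).
have {}rowE i s : (a == Some i) && ((b == None) || (s == t)) =
    (a' == Some i) && ((b' == None) || (s == t')).
  by have := rowE i s; rewrite !in_prism_edge_row.
have {}colE j s : (b == Some j) && ((a == None) || (s == t)) =
    (b' == Some j) && ((a' == None) || (s == t')).
  by have := colE j s; rewrite !in_prism_edge_col.
have Ea : a = a'.
  case: a a' {E nN colE} rowE => [i|] [i'|] // rowE.
  - by have := rowE i t; rewrite !eqxx orbT => /esym/andP[/eqP].
  - by have := rowE i t; rewrite !eqxx orbT.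
  - by have := rowE i' t'; rewrite !eqxx orbT.
have Eb : b = b'.
  case: b b' {E nN rowE} colE => [i|] [i'|] // colE.
  - by have := colE i t; rewrite !eqxx orbT => /esym/andP[/eqP].
  - by have := colE i t; rewrite !eqxx orbT.
  - by have := colE i' t'; rewrite !eqxx orbT.
split; first by rewrite Ea Eb.
rewrite -{}Ea -{}Eb in rowE *; case: a b {E nN colE} rowE => [i|] // [j|] // rowE _.
by have := rowE i t; rewrite !eqxx /= => /esym/eqP.
Qed.

Lemma mem_prism_edges e : (e \in edges G) =
  [exists q : 'I_2 * (line * line), (q.2 != (None, None)) && (e == prism_edge q.1 q.2)].
Proof.
apply/imsetP/existsP => [[[[x s] [y s']] xy ->]|[[t [a b]] /andP[ab /eqP->]]].
  have s2 (r : 'I_2) : s != s' -> (r == s) || (r == s').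
    by rewrite -!val_eqE /=; move: (ltn_ord r) (ltn_ord s) (ltn_ord s'); clear; lia.
  move: xy; rewrite inE /= /cart_adj /= => /orP[] /andP[/eqP E].
    rewrite -{}E => ss'; case: x => [i|j].
      exists (s, (Some i, None)); apply/andP; split=> //; apply/eqP/setP => -[[k|k] r].
        rewrite in_prism_edge_row !inE !xpair_eqE /=.
        by rewrite -andb_orr (s2 r ss') eq_sym.
      by rewrite in_prism_edge_col !inE.
    exists (s, (None, Some j)); apply/andP; split=> //; apply/eqP/setP => -[[k|k] r].
      by rewrite in_prism_edge_row !inE.
    rewrite in_prism_edge_col !inE !xpair_eqE /=.
    by rewrite -andb_orr (s2 r ss') eq_sym.
  rewrite -{}E; case: x y => [i|j] [i'|j'] // _.
    exists (s, (Some i, Some j')); apply/andP; split=> //; apply/eqP/setP => -[[k|k] r].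
      by rewrite in_prism_edge_row !inE !xpair_eqE /= orbF eq_sym.
    by rewrite in_prism_edge_col !inE !xpair_eqE /= eq_sym.
  exists (s, (Some i', Some j)); apply/andP; split=> //; apply/eqP/setP => -[[k|k] r].
    by rewrite in_prism_edge_row !inE !xpair_eqE /= eq_sym.
  by rewrite in_prism_edge_col !inE !xpair_eqE /= orbF eq_sym.
have r2 (r : 'I_2) : (r == ord0) || (r == ord_max).
  by rewrite -!val_eqE /=; have := ltn_ord r; clear; lia.
case: a b ab => [i|] [j|] // _.
- exists ((inl i, t), (inr j, t)); first by rewrite inE /= /cart_adj /= eqxx ?orbT.
  by apply/setP => -[[k|k] r]; rewrite ?in_prism_edge_row ?in_prism_edge_col !inE !xpair_eqE /= ?orbF eq_sym.
- exists ((inl i, ord0), (inl i, ord_max)); first by rewrite inE /= /cart_adj /= eqxx.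
  apply/setP => -[[k|k] r]; rewrite ?in_prism_edge_row ?in_prism_edge_col !inE !xpair_eqE //=.
  by rewrite -andb_orr r2 !andbT eq_sym.
- exists ((inr j, ord0), (inr j, ord_max)); first by rewrite inE /= /cart_adj /= eqxx.
  apply/setP => -[[k|k] r]; rewrite ?in_prism_edge_row ?in_prism_edge_col !inE !xpair_eqE //=.
  by rewrite -andb_orr r2 !andbT eq_sym.
Qed.

End Prism.

Theorem theorem2p5 (n : nat) (hn : 2 <= n)
  (phi : {set 'K_(n, n) □ 'K_2} -> option 'I_n.+1)
  (hphi : edge_precoloring phi)
  (hcard : #|colored phi| = n) :
  exists f : {set 'K_(n, n) □ 'K_2} -> 'I_n.+1,
    proper_edge_coloring f /\ extends f phi.
Proof.
have [_ phi_proper] := hphi.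
pose R : {set option 'I_n} := [set~ None]; pose S : {set option 'I_n.+1} := [set~ None].
pose E t p := @prism_edge n t p.
pose D t := [set p : option 'I_n * option 'I_n | (p != (None, None)) && (phi (E t p) != None)].
have cR : #|R| = n by rewrite cardsC1 card_option card_ord.
have inL (a : option 'I_n) : a \in None |: R by rewrite !inE orbN.
have borderE p : on_border R R p = (p.1 == None) || (p.2 == None).
  by rewrite /on_border !inE !negbK.
have EborderE t t' p : on_border R R p -> E t p = E t' p.
  by rewrite borderE; apply: prism_edge_border.
have DP t p : reflect (p != (None, None) /\ phi (E t p) != None) (p \in D t).
  by rewrite inE; apply: andP.
have Einj t : {in D t &, injective (E t)}.
  by move=> p q /DP[pN _] _ /(prism_edge_inj pN)[].
have frame t p : p \in D t -> in_frame None None R R p.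
  move=> /DP[pN _]; rewrite /in_frame !inL /=.
  by case: p pN => [[i|] [j|]] // _; rewrite !inE.
have DS t p : p \in D t -> phi (E t p) \in S by move=> /DP[_]; rewrite !inE.
have Dpl t : partial_latin R R (D t) (fun p => phi (E t p)).
  move=> p q pD qD pq Epq.
  have meet v : v \in E t p -> v \in E t q -> False.
    move=> vp vq; have := phi_proper (E t p) (E t q); rewrite !inE.
    move: (DP _ _ pD) (DP _ _ qD) => [_ ->] [_ ->] /(_ isT isT).
    rewrite Epq eqxx; case/(_ _ _)/negP => //.
      by apply: contraNneq pq => /Einj->.
    by apply/set0Pn; exists v; rewrite in_setI vp.
  split=> Eq; apply/negP.
    case Ei: p.1 => [i|]; last by rewrite !inE.
    by move=> _; apply: (meet (inl i, t)); rewrite in_prism_edge_row -?Eq Ei !eqxx orbT.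
  case Ej: p.2 => [j|]; last by rewrite !inE.
  by move=> _; apply: (meet (inr j, t)); rewrite in_prism_edge_col -?Eq Ej !eqxx orbT.
have leD : #|D ord0| + #|[set p in D ord_max | ~~ on_border R R p]| <= #|R|.
  set I1 := [set p in _ | _].
  have I1P p : p \in I1 -> p \in D ord_max /\ ~~ on_border R R p by case/setIdP.
  rewrite cR -[leqRHS]hcard -(card_in_imset (Einj ord0)).
  have I1inj : {in I1 &, injective (E ord_max)}.
    by move=> p q /I1P[pD _] /I1P[qD _]; apply: Einj.
  rewrite -(card_in_imset I1inj) -cardsUI.
  have -> : (E ord0 @: D ord0) :&: (E ord_max @: I1) = set0.
    apply/setP => e; rewrite in_set0; apply/negP => /setIP[/imsetP[p /DP[pN _] ->]].
    move=> /imsetP[q /I1P[_ qI] Epq]; have [Ep Et] := prism_edge_inj pN Epq.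
    by move: qI; rewrite -Ep borderE negb_or => /Et.
  rewrite cards0 addn0; apply: subset_leq_card; rewrite subUset.
  apply/andP; split; apply/subsetP => e /imsetP[p].
    by move=> /DP[_ pN] ->; rewrite inE.
  by move=> /I1P[/DP[_ pN] _] ->; rewrite inE.
have [|||||||B0 [B1 [BP0 BP1 BD0 BD1 [Br Bc]]]] := @two_layers _ _ _ None None R R S
    (D ord0) (D ord_max) _ _ None _ _ erefl _ _ (frame _) (frame _) (DS _) (DS _)
    (Dpl _) (Dpl _).
- by rewrite !inE.
- by rewrite !inE.
- by rewrite cardsC1 card_option card_ord cR.
- by rewrite !inE.
- by move=> p pb; rewrite !inE (EborderE ord0 ord_max).
- by move=> p pb /=; rewrite (EborderE ord0 ord_max).
- exact: leD.
pose B (t : 'I_2) := if t == ord0 then B0 else B1.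
have ord2 (t : 'I_2) : t = ord0 \/ t = ord_max.
  by case: t => [[|[|k]] lt] //; [left|right]; apply: val_inj.
have BP t : bordered_latin None None R R S (B t) by rewrite /B; case: ifP.
have BD t : completes (D t) (fun p => phi (E t p)) (B t).
  by case: (ord2 t) => ->; rewrite /B ?eqxx.
have Bborder t t' p : p != (None, None) -> on_border R R p -> B t p.1 p.2 = B t' p.1 p.2.
  have eq01 : p != (None, None) -> on_border R R p -> B0 p.1 p.2 = B1 p.1 p.2.
    by rewrite borderE; case: p => [[i|] [j|]] //= _ _; [apply: Br|apply: Bc]; rewrite !inE.
  by move=> pN pb; rewrite /B; case: ifP; case: ifP => // _ _; rewrite eq01.
have Bsome t p : p != (None, None) -> B t p.1 p.2 != None.
  have [BSr BSc _ _] := BP t; case: p => [[i|] [j|]] // _; rewrite /=.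
  - by have := BSr (Some i) (Some j); rewrite !inE => /(_ isT isT).
  - by have := BSr (Some i) None; rewrite !inE => /(_ isT isT).
  - by have := BSc None (Some j); rewrite !inE => /(_ isT isT).
pose f e := odflt ord0 (if [pick q : 'I_2 * (option 'I_n * option 'I_n) |
    (q.2 != (None, None)) && (E q.1 q.2 == e)] is Some q then B q.1 q.2.1 q.2.2 else None).
have fE t p : p != (None, None) -> Some (f (E t p)) = B t p.1 p.2.
  move=> pN; rewrite /f; case: pickP => [[t' q] /= /andP[qN /eqP Eq]|/(_ (t, p))]; last first.
    by rewrite /= pN eqxx.
  have [Eqp Et] := prism_edge_inj qN Eq; rewrite {q}Eqp in qN Eq Et *.
  have -> : B t' p.1 p.2 = B t p.1 p.2.
    have [pb|] := boolP (on_border R R p); first exact: Bborder.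
    by rewrite borderE negb_or => /Et->.
  by case: (B t p.1 p.2) (Bsome t p pN).
have edgeP e : e \in edges ('K_(n, n) □ 'K_2) -> exists t p, p != (None, None) /\ e = E t p.
  by rewrite mem_prism_edges => /existsP[[t p] /andP[pN /eqP->]]; exists t, p.
exists f; split.
  move=> _ _ /edgeP[t [p [pN ->]]] /edgeP[t' [p' [p'N ->]]] neq /set0Pn[v /setIP[vp vp']].
  have at_layer s q r : q != (None, None) ->
      (q.1 == None) || (q.2 == None) || (s == r) -> E r q = E s q /\ B r q.1 q.2 = B s q.1 q.2.
    move=> qN; rewrite -borderE => /orP[qb|/eqP->//].
    by split; [apply: EborderE|apply: Bborder].
  apply: contraNneq neq => Ef; have := fE t p pN; rewrite Ef fE // => {Ef}/esym.
  case: v vp vp' => [[i|j] s].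
    rewrite !in_prism_edge_row => /andP[/eqP p1 ps] /andP[/eqP p'1 p's].
    have [-> ->] : E t p = E s p /\ B t p.1 p.2 = B s p.1 p.2.
      by apply: at_layer => //; rewrite p1.
    have [-> ->] : E t' p' = E s p' /\ B t' p'.1 p'.2 = B s p'.1 p'.2.
      by apply: at_layer => //; rewrite p'1.
    have [_ _ Binj _] := BP s; rewrite p1 p'1 => /Binj p2.
    by rewrite [p]surjective_pairing [p']surjective_pairing p1 p'1 p2 ?inL // !inE.
  rewrite !in_prism_edge_col => /andP[/eqP p2 ps] /andP[/eqP p'2 p's].
  have [-> ->] : E t p = E s p /\ B t p.1 p.2 = B s p.1 p.2.
    by apply: at_layer => //; rewrite p2 orbF.
  have [-> ->] : E t' p' = E s p' /\ B t' p'.1 p'.2 = B s p'.1 p'.2.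
    by apply: at_layer => //; rewrite p'2 orbF.
  have [_ _ _ Binj] := BP s; rewrite p2 p'2 => /Binj p1.
  by rewrite [p]surjective_pairing [p']surjective_pairing p2 p'2 p1 ?inL // !inE.
move=> e ec; have /edgeP[t [p [pN Ee]]] : e \in edges ('K_(n, n) □ 'K_2).
  by apply: (subsetP (proj1 hphi)).
rewrite Ee fE // BD //; apply/DP; split=> //.
by move: ec; rewrite inE Ee.
Qed.
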